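(* Let $f=e^{-u}$, $g=e^{-v}$ belong to $\mathcal{A}'$, and assume that $g$ is an admissible perturbation for $f$. Then $\delta J(f,g)$ is finite and is given by $$\delta J(f,g)=\int_{\mathbb{R}^n}\psi\,d\mu(f),\qquad \text{where } \psi=v^*.$$
   Context: Fix $n\ge 1$. For a convex function $u:\mathbb{R}^n\to\mathbb{R}\cup\{+\infty\}$, $\mathrm{dom}(u)=\{x: u(x)\in\mathbb{R}\}$, $u$ is proper if $\mathrm{dom}(u)\ne\emptyset$, and $u^*(y)=\sup_{x\in\mathbb{R}^n}(\langle x,y\rangle-u(x))$ is its Fenchel conjugate. $\mathcal{L}$ is the set of proper convex $u:\mathbb{R}^n\to\mathbb{R}\cup\{+\infty\}$ with $\lim_{\|x\|\to+\infty}u(x)=+\infty$, and $\mathcal{A}=\{e^{-u}: u\in\mathcal{L}\}$ (with $e^{-\infty}=0$). Operations: $u\Box v(x)=\inf_{y\in\mathbb{R}^n}\{u(x-y)+v(y)\}$; $(u\alpha)(x)=\alpha u(x/\alpha)$ for $\alpha>0$, and $u0=I_{\{0\}}$ (equal to $0$ at the origin and $+\infty$ elsewhere). For $f=e^{-u}$, $g=e^{-v}$ in $\mathcal{A}$ and $t\ge0$, $f\oplus t\cdot g=e^{-[u\Box(vt)]}$. $J(f)=\int_{\mathbb{R}^n}f\,dx$ and $\delta J(f,g)=\lim_{t\to0^+}\frac{J(f\oplus t\cdot g)-J(f)}{t}$ (first variation of $J$ at $f$ along $g$). $\mathcal{L}'$ is the set of $u\in\mathcal{L}$ such that $\mathrm{dom}(u)=\mathbb{R}^n$,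 $u\in C^2(\mathbb{R}^n)$ with positive definite Hessian at every point, and $\lim_{\|x\|\to+\infty}u(x)/\|x\|=+\infty$. $\mathcal{A}'=\{e^{-u}:u\in\mathcal{L}'\}$. For $f=e^{-u}\in\mathcal{A}'$, $\mu(f)$ is the Borel measure on $\mathbb{R}^n$ that is the push-forward under $\nabla u$ of the measure with density $f$ with respect to Lebesgue measure. $g=e^{-v}$ is an admissible perturbation for $f=e^{-u}$ if there exists $c>0$ such that $u^*-c\,v^*$ is convex. *)

(* Defs.v *)
From HB Require Import structures.
From mathcomp Require Import all_boot all_order all_algebra.
From mathcomp Require Import all_classical all_reals all_analysis.
From mathcomp Require Import measurable_realfun.

Set Implicit Arguments.
Unset Strict Implicit.
Unset Printing Implicit Defensive.

Import Order.TTheory GRing.Theory Num.Theory.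
Import numFieldNormedType.Exports.

Local Open Scope classical_set_scope.
Local Open Scope ring_scope.

(* R^n is 'rV[R]_n, with the Borel sigma-algebra. *)

Section borel_matrix.
Context {R : realType} (m n : nat).
Notation G := (@open 'M[R]_(m, n)).

HB.instance Definition _ := @isMeasurable.Build (sigma_display G) 'M[R]_(m, n)
  <<s G >> (@sigma_algebra0 _ setT G) (@sigma_algebraC _ G)
  (@sigma_algebra_bigcup _ setT G).

End borel_matrix.

Section borel_coordinates.
Context {R : realType} (n : nat).

Lemma measurable_rV_coord (i : 'I_n) :
  measurable_fun [set: 'rV[R]_n] (fun x : 'rV[R]_n => x 0 i).
Proof.
apply: (measurability _ (RGenOpens.measurableE R)).
move=> _ [_ [a [b ->]] <-]; rewrite setTI; apply: sub_sigma_algebra.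
apply: open_comp; last exact: interval_open.
by move=> x _; exact: coord_continuous.
Qed.

Lemma measurable_fun_rV d (T : measurableType d) (f : T -> 'rV[R]_n) :
  (forall i, measurable_fun [set: T] (fun t => f t 0 i)) ->
  measurable_fun [set: T] f.
Proof.
move=> mf; apply: (@measurability _ _ _ _ _ _ (@open 'rV[R]_n)) => //.
move=> _ [U oU <-]; rewrite setTI.
pose box (q : 'rV[rat]_n * rat) : set 'rV[R]_n :=
  [set y | forall i, `|ratr (q.1 0 i) - y 0 i| < ratr q.2].
have -> : f @^-1` U = \bigcup_(q in [set q | box q `<=` U]) (f @^-1` box q).
  apply/seteqP; split=> [t Uft|t [q /= qU]]; last exact: qU.
  have /nbhs_ballP[e /= e0 eU] : nbhs (f t) U by exact: open_nbhs_nbhs.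
  have [r] := rat_in_itvoo (divr_gt0 e0 (ltr0Sn R 1)).
  rewrite in_itv/= => /andP[r0 re].
  have /choice[q qP] : forall i, exists q : rat,
      f t 0 i < ratr q < f t 0 i + ratr r.
    move=> i; have lt_i : f t 0 i < f t 0 i + ratr r by rewrite ltrDl.
    by have [q] := rat_in_itvoo lt_i; rewrite in_itv/=; exists q.
  exists (\row_i q i, r) => [y /= yq|i] /=; last first.
    rewrite mxE; have /andP[q1 q2] := qP i.
    by rewrite gtr0_norm ?subr_gt0// ltrBlDl.
  apply: eU; split => // j i; rewrite (ord1 j) /ball/=.
  have := yq i; rewrite mxE => yqi.
  rewrite -(subrKA (ratr (q i))) (le_lt_trans (ler_normD _ _))//.
  have /andP[q1 q2] := qP i.
  rewrite [e]splitr ltrD//; last exact: lt_trans re.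
  by rewrite distrC gtr0_norm ?subr_gt0// (lt_trans _ re)// ltrBlDl.
rewrite bigcup_mkcond; apply: countable_bigcupT_measurable => // q.
case: ifPn => // _.
have -> : f @^-1` box q = \bigcap_(i in [set: 'I_n])
    ((fun t => f t 0 i) @^-1` [set y | `|ratr (q.1 0 i) - y| < ratr q.2]).
  by apply/seteqP; split=> t /= h i => [_|]; exact: h.
apply: fin_bigcap_measurable => // i _.
rewrite -[X in measurable X]setTI; apply: mf => //.
by apply: open_measurable; exact: (@ball_open _ R^o _ (ratr q.2)).
Qed.

End borel_coordinates.

Definition rV_cons {R : realType} {n : nat} (p : R * 'rV[R]_n) : 'rV[R]_n.+1 :=
  \row_i if unlift ord0 i is Some j then p.2 0 j else p.1.

Lemma measurable_rV_cons {R : realType} {n : nat} :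
  measurable_fun [set: R * 'rV[R]_n] (@rV_cons R n).
Proof.
apply: measurable_fun_rV => i; under eq_fun do rewrite mxE.
case: (unliftP ord0 i) => [j|] _; last exact: measurable_fst.
exact: (measurableT_comp (measurable_rV_coord j)).
Qed.

Section lebesgue_cons.
Local Open Scope ereal_scope.
Context {R : realType} {n : nat}.
Variable m : {sigma_finite_measure set 'rV[R]_n -> \bar R}.

Definition lebesgue_cons : set 'rV[R]_n.+1 -> \bar R :=
  pushforward (@lebesgue_measure R \x m) (@rV_cons R n).

Let preimage_rV_cons (A : set 'rV[R]_n.+1) : measurable A ->
  measurable (@rV_cons R n @^-1` A).
Proof.
by move=> mA; rewrite -[X in measurable X]setTI; exact: measurable_rV_cons.
Qed.

Let lebesgue_cons0 : lebesgue_cons set0 = 0.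
Proof. by rewrite /lebesgue_cons /pushforward preimage_set0 measure0. Qed.

Let lebesgue_cons_ge0 A : 0 <= lebesgue_cons A.
Proof. exact: (measure_ge0 (@lebesgue_measure R \x m)). Qed.

Let lebesgue_cons_sigma_additive : semi_sigma_additive lebesgue_cons.
Proof.
move=> F mF tF mUF; rewrite /lebesgue_cons /pushforward preimage_bigcup.
apply: (@measure_semi_sigma_additive _ _ _ (@lebesgue_measure R \x m)).
- by move=> i; exact: preimage_rV_cons.
- apply/trivIsetP => /= i j _ _ ij; rewrite -preimage_setI.
  by move/trivIsetP : tF => /(_ _ _ _ _ ij) ->//; rewrite preimage_set0.
- by rewrite -preimage_bigcup; exact: preimage_rV_cons.
Qed.

HB.instance Definition _ := isMeasure.Build _ _ _ lebesgue_cons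
  lebesgue_cons0 lebesgue_cons_ge0 lebesgue_cons_sigma_additive.

Let lebesgue_cons_sigma_finite : sigma_finite [set: 'rV[R]_n.+1] lebesgue_cons.
Proof.
have /sigma_finiteP[F [FT ndF Foo]] := sigma_finiteT (@lebesgue_measure R).
have /sigma_finiteP[G [GT ndG Goo]] := sigma_finiteT m.
pose uncons (x : 'rV[R]_n.+1) : R * 'rV[R]_n :=
  (x 0%R ord0, \row_i x 0%R (lift ord0 i)).
have consK : cancel (@rV_cons R n) uncons.
  move=> [a y]; rewrite /uncons /rV_cons mxE unlift_none; congr pair.
  by apply/rowP => i; rewrite !mxE liftK.
have muncons : measurable_fun setT uncons.
  apply: measurable_fun_pair; first exact: measurable_rV_coord.
  apply: measurable_fun_rV => i; under eq_fun do rewrite mxE.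
  exact: measurable_rV_coord.
exists (fun k => uncons @^-1` (F k `*` G k)).
  apply/esym; rewrite -subTset => x _.
  have : (\bigcup_k F k) (uncons x).1 by rewrite -FT.
  have : (\bigcup_k G k) (uncons x).2 by rewrite -GT.
  move=> [j _ Gj] [i _ Fi]; exists (maxn i j) => //; split.
    by move: Fi; apply/subsetPset/ndF/leq_maxl.
  by move: Gj; apply/subsetPset/ndG/leq_maxr.
move=> k; have [mF Fk] := Foo k; have [mG Gk] := Goo k; split.
  by rewrite -[X in measurable X]setTI; apply: muncons => //; exact: measurableX.
rewrite /lebesgue_cons /pushforward -comp_preimage.
rewrite (_ : uncons \o _ = id); last by apply/funext => p /=; rewrite consK.
by rewrite preimage_id product_measure1E// lte_mul_pinfty// ge0_fin_numE.
Qed.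

HB.instance Definition _ := Measure_isSigmaFinite.Build _ _ _ lebesgue_cons
  lebesgue_cons_sigma_finite.

End lebesgue_cons.

(* Lebesgue measure on the Borel sets of R^n: the n-fold product of
   [lebesgue_measure], a point mass when n = 0. *)
Fixpoint lebesgue_rV (R : realType) (n : nat) :
    {sigma_finite_measure set 'rV[R]_n -> \bar R} :=
  if n is n'.+1 then lebesgue_cons (lebesgue_rV R n')
  else dirac (0%R : 'rV[R]_0).

Section convex_functions.
Local Open Scope ereal_scope.
Context {R : realType} {n : nat}.
Implicit Types (u v : 'rV[R]_n -> \bar R) (x y : 'rV[R]_n) (t : R).

Definition dotv x y : R := (\sum_(i < n) x 0%R i * y 0%R i)%R.

(* The norm of the library on 'rV[R]_n is the sup norm. *)
Definition enorm x : R := Num.sqrt (dotv x x).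

Definition enorm_pinfty : set_system 'rV[R]_n :=
  filter_from [set: R] (fun r => [set x | (r < enorm x)%R]).

Global Instance enorm_pinfty_filter : Filter enorm_pinfty.
Proof.
apply: filter_from_filter; first by exists 0%R.
move=> r s _ _; exists (Num.max r s) => // x /=.
by rewrite gt_max => /andP[].
Qed.

(* Convexity of a function with values in R U {+oo}; 0 * +oo = 0. *)
Definition econvex u : Prop :=
  (forall x, u x != -oo) /\
  forall x y t, (0 <= t <= 1)%R ->
    u ((1 - t) *: x + t *: y)%R <= (1 - t)%:E * u x + t%:E * u y.

Definition edom u : set 'rV[R]_n := [set x | u x \is a fin_num].

Definition fenchel u y : \bar R :=
  ereal_sup (range (fun x => (dotv x y)%:E - u x)).

Definition infconv u v x : \bar R :=
  ereal_inf (range (fun y => u (x - y)%R + v y)).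

Definition rscale u t x : \bar R :=
  if t == 0%R then (if x == 0%R then 0 else +oo) else t%:E * u (t^-1 *: x)%R.

Definition classL u : Prop :=
  [/\ econvex u, edom u !=set0 & u x @[x --> enorm_pinfty] --> +oo].

End convex_functions.

Section differential.
Context {R : realType} {n : nat}.
Implicit Types (h : 'rV[R]_n -> R) (x : 'rV[R]_n).

Definition partial (i : 'I_n) h : 'rV[R]_n -> R := 'D_(delta_mx 0 i) h.

Definition gradient h x : 'rV[R]_n := \row_i partial i h x.

Definition hessian h x : 'M[R]_n := \matrix_(i, j) partial j (partial i h) x.

Definition is_C1 h : Prop :=
  continuous h /\
  forall i, (forall x, derivable h x (delta_mx 0 i)) /\
            continuous (partial i h).

Definition is_C2 h : Prop := is_C1 h /\ forall i, is_C1 (partial i h).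

Definition posdef (A : 'M[R]_n) : Prop :=
  forall w : 'rV[R]_n, w != 0 -> 0 < (w *m A *m w^T) 0 0.

End differential.

Section log_concave.
Local Open Scope ereal_scope.
Context {R : realType} {n : nat}.
Implicit Types (u v f g : 'rV[R]_n -> \bar R) (t : R).

Definition classL' u : Prop :=
  [/\ classL u,
      edom u = setT,
      is_C2 (fine \o u),
      forall x, posdef (hessian (fine \o u) x)
    & u x * ((enorm x)^-1)%:E @[x --> enorm_pinfty] --> +oo].

Definition exp_neg u : 'rV[R]_n -> \bar R := fun x => expeR (- u x).

(* The function u such that f = exp_neg u. *)
Definition potential f : 'rV[R]_n -> \bar R := fun x => - lne (f x).

Definition classA' f : Prop := exists u, classL' u /\ f = exp_neg u.

(* f (+) t . g *)
Definition oplus f t g : 'rV[R]_n -> \bar R :=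
  exp_neg (infconv (potential f) (rscale (potential g) t)).

Definition totalJ f : \bar R := \int[lebesgue_rV R n]_x f x.

Definition Jquotient f g t : \bar R :=
  (totalJ (oplus f t g) - totalJ f) * (t^-1)%:E.

Definition deltaJ f g : \bar R := lim (Jquotient f g t @[t --> 0^'+]).

(* mu(f), as a set function on the Borel sets: the push-forward under the
   gradient of the potential of the measure with density f. *)
Definition mu_of f : set 'rV[R]_n -> \bar R :=
  pushforward (fun A => \int[lebesgue_rV R n]_(x in A) f x)
    (gradient (fine \o potential f)).

Definition admissible f g : Prop :=
  exists2 c : R, (0 < c)%R &
    econvex (fun y => fenchel (potential f) y -
                      c%:E * fenchel (potential g) y).

End log_concave.

(* Main.v *)
Require Import Defs.
From mathcomp Require Import all_boot all_order all_algebra.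
From mathcomp Require Import all_classical all_reals all_analysis.
From mathcomp Require Import measurable_realfun.
From mathcomp Require Import ring lra.
From HB Require Import structures.

Set Implicit Arguments.
Unset Strict Implicit.
Unset Printing Implicit Defensive.

Import Order.TTheory GRing.Theory Num.Theory.
Import numFieldNormedType.Exports.

Local Open Scope classical_set_scope.
Local Open Scope ring_scope.

(** Write f = exp (- h) and g = exp (- k), let H and K be the conjugates of h
    and k, and J the integral of f.  For t > 0 the potential of the perturbed
    function is h_t x = inf_z (h (x - t z) + t k z).

    Pointwise the claim is elementary.  The tangent of h at x gives
    h_t x >= h x - t K (grad h x), and a fixed z gives an upper bound of h_t x
    whose slope at t = 0 is k z - <z, grad h x>; the infimum of these slopes
    over z is - K (grad h x).  So (exp (- h_t x) - f x) / t tends to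
    K (grad h x) f x ([cvg_quotient]).

    The difficulty is to integrate this limit, because grad h may grow
    arbitrarily fast where f is small.  Here admissibility enters: H - c K is
    convex, hence lies above an affine function <a, .> + b
    ([convex_affine_minorant]).  With s = t / c, the tangent of h at
    xi = a + (x - a) / (1 + s) then gives h_t x >= (1 + s) h xi + s b
    ([perturbed_ge_dilation]).  If m is a lower bound of h, the difference
    quotient is thus at most (exp (- h xi - s (b + m)) - f x) / t.  The
    integral of this majorant follows from a change of variables: it is
    ((1 + s)^n exp (- s (b + m)) - 1) J / t, which tends to (n - b - m) J / c.
    The majorant itself tends to (<x - a, grad h x> - b - m) f x / c.

    The integral of that limit is the limit of the integrals, because the
    integral of <x - a, grad h x> f x is n J ([integral_radial_derivative]).
    This integration by parts is the Tonelli theorem applied to the derivative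
    of f along the dilations with centre a.  Convergent majorants whose
    integrals converge to the integral of their limit are what the lemma of
    Pratt ([pratt_convergence]) asks for, so the quotients can be integrated in
    the limit.  The transfer formula for image measures
    ([integral_density_pushforward]) rewrites the result as an integral with
    respect to mu(f). *)

(** * Differentiation of convex functions *)

Section inner_product.
Context {R : realType} {n : nat}.
Implicit Types (x y z : 'rV[R]_n) (a : R).

Lemma dotvC x y : dotv x y = dotv y x.
Proof. by apply: eq_bigr => i _; rewrite mulrC. Qed.

Lemma dotvDl x y z : dotv (x + y) z = dotv x z + dotv y z.
Proof. by rewrite -big_split; apply: eq_bigr => i _; rewrite mxE mulrDl. Qed.

Lemma dotvZl a x y : dotv (a *: x) y = a * dotv x y.
Proof. by rewrite mulr_sumr; apply: eq_bigr => i _; rewrite mxE mulrA. Qed.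

Lemma dotvDr x y z : dotv x (y + z) = dotv x y + dotv x z.
Proof. by rewrite dotvC dotvDl !(dotvC x). Qed.

Lemma dotvZr a x y : dotv x (a *: y) = a * dotv x y.
Proof. by rewrite dotvC dotvZl dotvC. Qed.

Lemma dotvNl x y : dotv (- x) y = - dotv x y.
Proof. by rewrite -scaleN1r dotvZl mulN1r. Qed.

Lemma dotvNr x y : dotv x (- y) = - dotv x y.
Proof. by rewrite dotvC dotvNl dotvC. Qed.

Lemma dotvBl x y z : dotv (x - y) z = dotv x z - dotv y z.
Proof. by rewrite dotvDl dotvNl. Qed.

Lemma dotvBr x y z : dotv x (y - z) = dotv x y - dotv x z.
Proof. by rewrite dotvDr dotvNr. Qed.

Lemma dotv_delta x (i : 'I_n) : dotv x (delta_mx 0 i) = x 0 i.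
Proof.
rewrite /dotv (bigD1 i)//= mxE !eqxx mulr1 big1 ?addr0// => j ji.
by rewrite mxE (negbTE ji) andbF mulr0.
Qed.

End inner_product.

Definition convex_rV {R : realType} {n : nat} (h : 'rV[R]_n -> R) : Prop :=
  forall x y t, 0 <= t <= 1 ->
    h ((1 - t) *: x + t *: y) <= (1 - t) * h x + t * h y.

Lemma near0_norm_lt {R : realType} (r : R) :
  0 < r -> \forall t \near (0 : R), `|t| < r.
Proof. exact: pseudometric_normed_Zmodule.nbhs0_lt. Qed.

(** In this form a directional derivative is an error estimate that holds at
    t = 0 as well and that combines with convexity inequalities without a
    division by t, hence without a case distinction on the sign of t. *)
Lemma is_deriveP {R : realType} {V : normedModType R} (h : V -> R)
    (x d : V) (l : R) : is_derive x d h l <->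
  forall e : R, 0 < e ->
    \forall t \near (0 : R), `|h (x + t *: d) - h x - t * l| <= e * `|t|.
Proof.
split.
  move=> [dh <-] e e0; move/cvgrPdist_le: dh => /(_ _ e0) /nbhs_ballP[r/= r0 hr].
  near=> t; have [->|t0] := eqVneq t 0.
    by rewrite scale0r addr0 subrr mul0r subrr normr0 mulr0.
  have := hr t; rewrite /ball/= sub0r normrN.
  have -> : `|t| < r by near: t; exact: near0_norm_lt.
  move=> /(_ isT t0); rewrite -(ler_pM2r (x := `|t|)) ?normr_gt0// -normrM.
  rewrite mulrBl mulrAC mulVf// mul1r distrC /= /GRing.scale/= (addrC (t *: d)).
  by rewrite -/(derive h x d) (mulrC _ t).
move=> H.
suff H' : t^-1 *: ((h \o shift x) (t *: d) - h x) @[t --> 0^'] --> l.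
  by apply: DeriveDef; [exact: (cvgP l)|exact: cvg_lim].
apply/cvgrPdist_le => e e0; have := H e e0; move=> /nbhs_ballP[r/= r0 hr].
near=> t; have t0 : t != 0 by near: t; exact: nbhs_dnbhs_neq.
rewrite -(ler_pM2r (x := `|t|)) ?normr_gt0// -normrM mulrBl.
rewrite [X in _ - X](_ : _ = h (x + t *: d) - h x); last first.
  by rewrite /GRing.scale/= mulrAC mulVf// mul1r (addrC (t *: d)).
rewrite distrC (mulrC l t); apply: hr; rewrite /ball/= sub0r normrN.
by near: t; apply: dnbhs0_lt.
Unshelve. all: by end_near. Qed.

Section directional_derivatives.
Context {R : realType} {n : nat}.
Implicit Types (h : 'rV[R]_n -> R) (x y d : 'rV[R]_n) (l : R).

Lemma is_derive_scalev h x d l a :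
  is_derive x d h l -> is_derive x (a *: d) h (a * l).
Proof.
move=> /is_deriveP H; apply/is_deriveP => e e0.
have e'0 : 0 < e / (`|a| + 1) by rewrite divr_gt0// ltr_wpDl.
have /nbhs_ballP[r/= r0 hr] := H _ e'0; near=> t.
rewrite scalerA mulrA; apply: (le_trans (hr _ _)).
  rewrite /ball/= sub0r normrN normrM.
  have : `|t| < r / (`|a| + 1).
    by near: t; apply: near0_norm_lt; rewrite divr_gt0// ltr_wpDl.
  rewrite ltr_pdivlMr ?ltr_wpDl//; apply: le_lt_trans.
  by rewrite ler_wpM2l//; lra.
rewrite normrM (mulrC `|t|) mulrA ler_wpM2r// mulrAC ler_pdivrMr ?ltr_wpDl//.
by rewrite ler_wpM2l ?ltW//; lra.
Unshelve. all: by end_near. Qed.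

(** Convexity replaces total differentiability.  The midpoint inequality bounds
    h (x + s (d1 + d2)) above by the mean of h at x + 2 s d1 and x + 2 s d2.
    Midpoint convexity at x of the values at x + s d and x - s d, with
    d = d1 + d2, turns the upper bound at - s into a lower bound at s. *)
Lemma convex_is_deriveD h x d1 d2 l1 l2 : convex_rV h ->
  is_derive x d1 h l1 -> is_derive x d2 h l2 ->
  is_derive x (d1 + d2) h (l1 + l2).
Proof.
move=> ch /is_deriveP H1 /is_deriveP H2; apply/is_deriveP => e e0.
have e20 : 0 < e / 2 by rewrite divr_gt0.
have /nbhs_ballP[r1/= r10 hr1] := H1 _ e20.
have /nbhs_ballP[r2/= r20 hr2] := H2 _ e20.
have half : 0 <= (2^-1 : R) <= 1 by apply/andP; split; lra.
have upper s : h (x + s *: (d1 + d2)) <=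
    2^-1 * h (x + (2 * s) *: d1) + 2^-1 * h (x + (2 * s) *: d2).
  have := ch (x + (2 * s) *: d1) (x + (2 * s) *: d2) _ half.
  have -> : 1 - 2^-1 = 2^-1 :> R by lra.
  rewrite (_ : 2^-1 *: _ + _ = x + s *: (d1 + d2))//.
  by apply/rowP => i; rewrite !mxE; field.
have mid s : 2 * h x <= h (x + s *: (d1 + d2)) + h (x + (- s) *: (d1 + d2)).
  have := ch (x + s *: (d1 + d2)) (x + (- s) *: (d1 + d2)) _ half.
  have -> : 1 - 2^-1 = 2^-1 :> R by lra.
  rewrite (_ : 2^-1 *: _ + _ = x); first by lra.
  by apply/rowP => i; rewrite !mxE; field.
near=> t.
have tr s : `|s| = `|t| -> `|2 * s| < r1 /\ `|2 * s| < r2.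
  move=> st; have h1 : `|t| < r1 / 2.
    by near: t; apply: near0_norm_lt; rewrite divr_gt0.
  have h2 : `|t| < r2 / 2 by near: t; apply: near0_norm_lt; rewrite divr_gt0.
  by rewrite normrM st ger0_norm//; split; lra.
have bnd s : `|s| = `|t| -> h (x + s *: (d1 + d2)) - h x - s * (l1 + l2) <= e * `|t|.
  move=> st; have [s1 s2] := tr s st.
  have := hr1 (2 * s); have := hr2 (2 * s).
  rewrite /ball/= !sub0r !normrN => /(_ s2) b2 /(_ s1) b1.
  move: b1 b2; rewrite !ler_norml => /andP[_ b1] /andP[_ b2].
  rewrite normrM st (ger0_norm (ler0n _ 2)) in b1 b2.
  by have := upper s; lra.
rewrite ler_norml; apply/andP; split; last exact: bnd.
have := bnd (- t); rewrite normrN => /(_ erefl).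
by have := mid t; lra.
Unshelve. all: by end_near. Qed.

(** Along the coordinate axes this is the definition of the gradient, and the
    directions at which it holds are closed under sums and scaling. *)
Lemma gradient_derive h x d : convex_rV h ->
  (forall i, derivable h x (delta_mx 0 i)) ->
  is_derive x d h (dotv (gradient h x) d).
Proof.
move=> ch dh; have dE : d = \sum_i d 0 i *: delta_mx 0 i by exact: row_sum_delta.
have -> : dotv (gradient h x) d = \sum_i d 0 i * partial i h x.
  by apply: eq_bigr => i _; rewrite mxE mulrC.
rewrite {1}dE; apply: (big_ind2 (fun v l => is_derive x v h l)).
- exact: is_derive0.
- by move=> d1 l1 d2 l2; exact: convex_is_deriveD.
- by move=> i _; apply: is_derive_scalev; apply: DeriveDef.
Qed.

Lemma convex_ge_tangent h x y l : convex_rV h ->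
  is_derive x (y - x) h l -> h x + l <= h y.
Proof.
move=> ch /is_deriveP H; apply/ler_addgt0Pr => e e0.
have /nbhs_ballP[r/= r0 hr] := H e e0.
pose t := Num.min 1 (r / 2).
have t0 : 0 < t by rewrite lt_min ltr01 divr_gt0.
have t1 : t <= 1 by rewrite ge_min lexx.
have tr : t < r by rewrite gt_min; apply/orP; right; lra.
have := hr t; rewrite /ball/= sub0r normrN (gtr0_norm t0) => /(_ tr).
rewrite ler_norml => /andP[+ _].
have := ch x y t; rewrite (ltW t0) t1 => /(_ isT).
rewrite (_ : _ *: x + _ = x + t *: (y - x)); last first.
  by apply/rowP => i; rewrite !mxE; ring.
move=> h1 h2; rewrite -(ler_pM2l t0) !mulrDr; lra.
Qed.

Lemma convex_ge_gradient h x y : convex_rV h ->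
  (forall i, derivable h x (delta_mx 0 i)) ->
  h x + dotv (gradient h x) (y - x) <= h y.
Proof.
by move=> ch dh; apply: convex_ge_tangent => //; exact: gradient_derive.
Qed.

Lemma is_derive_line h x d r : convex_rV h ->
  (forall z i, derivable h z (delta_mx 0 i)) ->
  is_derive r (1 : R) (fun s : R => h (x + s *: d))
    (dotv (gradient h (x + r *: d)) d).
Proof.
move=> ch dh.
have /is_deriveP H := gradient_derive d ch (dh (x + r *: d)).
apply/is_deriveP => e /H; apply: filterS => t.
have -> : t *: (1 : R) = t by rewrite /GRing.scale/= mulr1.
by rewrite scalerDl addrA.
Qed.

End directional_derivatives.

(** * Affine minorants of convex functions *)

Section affine_minorant.
Context {R : realType} {n : nat}.
Implicit Types (w : 'rV[R]_n -> R) (x y a : 'rV[R]_n).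

(** The finite-dimensional Hahn-Banach argument: an affine minorant on the span
    of the first k axes is extended along the next axis.  The slopes that are
    allowed there form the interval between the left and the right difference
    quotients, and its left end point is a supremum. *)
Lemma convex_affine_minorant w : convex_rV w ->
  exists a, forall y, w 0 + dotv y a <= w y.
Proof.
move=> cw.
suff H k : (k <= n)%N -> exists a, forall y,
    (forall i : 'I_n, (k <= i)%N -> y 0 i = 0) -> w 0 + dotv y a <= w y.
  have [a ha] := H n (leqnn n); exists a => y; apply: ha => i.
  by rewrite leqNgt ltn_ord.
elim: k => [_|k IH kn].
  exists 0 => y y0; rewrite (_ : y = 0); last by apply/rowP => i; rewrite y0 ?mxE.
  by rewrite [dotv _ _]big1 ?addr0// => i _; rewrite mxE mul0r.
have [a ha] := IH (ltnW kn); pose e : 'rV[R]_n := delta_mx 0 (Ordinal kn).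
pose slice := [set y : 'rV[R]_n | forall i : 'I_n, (k <= i)%N -> y 0 i = 0].
pose left_ := [set (w 0 + dotv p.1 a - w (p.1 - p.2 *: e)) / p.2 |
               p in [set p : 'rV[R]_n * R | slice p.1 /\ 0 < p.2]].
(* Convexity on the segment from y1 - r e to y2 + s e, which meets the slice at
   the weights s / (r + s) and r / (r + s). *)
have ordered y1 y2 (r s : R) : slice y1 -> slice y2 -> 0 < r -> 0 < s ->
    (w 0 + dotv y1 a - w (y1 - r *: e)) / r <=
    (w (y2 + s *: e) - dotv y2 a - w 0) / s.
  move=> y1s y2s r0 s0; have rs0 : 0 < r + s by rewrite addr_gt0.
  have rsN : r + s != 0 by rewrite gt_eqF.
  have t01 : 0 <= r / (r + s) <= 1.
    apply/andP; split; first by rewrite divr_ge0// ltW.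
    by rewrite ler_pdivrMr// mul1r; lra.
  have := cw (y1 - r *: e) (y2 + s *: e) _ t01.
  have -> : 1 - r / (r + s) = s / (r + s) by field.
  rewrite (_ : _ + _ = (s / (r + s)) *: y1 + (r / (r + s)) *: y2); last first.
    by apply/rowP => i; rewrite !mxE; field.
  move=> c1; have c2 : w 0 + dotv ((s / (r + s)) *: y1 + (r / (r + s)) *: y2) a <=
      w ((s / (r + s)) *: y1 + (r / (r + s)) *: y2).
    by apply: ha => i ki; rewrite !mxE y1s// y2s// !mulr0 addr0.
  have cancel (q X : R) : q / (r + s) * X * (r + s) = q * X by field.
  have c3 := le_trans c2 c1.
  rewrite dotvDl !dotvZl -(ler_pM2r rs0) !mulrDl !cancel in c3.
  by rewrite ler_pdivrMr// mulrAC ler_pdivlMr//; lra.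
have slice0 : slice 0 by move=> i _; rewrite mxE.
have left_sup : has_sup left_.
  split; first by eexists; exists (0, 1) => //; split.
  exists ((w (0 + 1 *: e) - dotv 0 a - w 0) / 1) => _ [[y r] /= [ys r0] <-].
  exact: ordered.
pose al := sup left_; exists (a + (al - a 0 (Ordinal kn)) *: e) => y yk.
pose y' := y - y 0 (Ordinal kn) *: e.
have y's : slice y'.
  move=> i; rewrite leq_eqVlt => /orP[/eqP ki|ki]; rewrite !mxE.
    by rewrite (_ : i = Ordinal kn) ?eqxx/= ?mulr1 ?subrr//; apply: val_inj.
  rewrite (yk i ki) (_ : (i == Ordinal kn) = false) ?andbF ?mulr0 ?subr0//.
  by apply/eqP => ik; rewrite ik ltnn in ki.
have yE : y = y' + y 0 (Ordinal kn) *: e by rewrite subrK.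
rewrite dotvDr dotvZr dotv_delta.
set yk0 := y 0 (Ordinal kn) in yE *.
have -> : dotv y a = dotv y' a + yk0 * a 0 (Ordinal kn).
  by rewrite yE dotvDl dotvZl [dotv e a]dotvC dotv_delta.
suff : w 0 + dotv y' a + al * yk0 <= w y by lra.
have [yk_neg|yk_pos|yk_0] := ltgtP yk0 0; last first.
- by rewrite yk_0 mulr0 addr0 yE yk_0 scale0r addr0; apply: ha.
- have : al <= (w y - dotv y' a - w 0) / yk0.
    apply: ge_sup; first exact: left_sup.1.
    by move=> _ [[y1 r] /= [y1s r0] <-]; rewrite [in leRHS]yE; exact: ordered.
  by rewrite ler_pdivlMr//; lra.
- have : (w 0 + dotv y' a - w y) / (- yk0) <= al.
    apply: sup_upper_bound => //; exists (y', - yk0) => /=.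
      by split=> //; rewrite oppr_gt0.
    by rewrite scaleNr opprK -yE.
  by rewrite ler_pdivrMr ?oppr_gt0//; lra.
Qed.

End affine_minorant.

(** * Superlinear convex functions and their conjugates *)

Lemma continuous_rV {R : realType} {n : nat} {T : topologicalType}
    (f : T -> 'rV[R]_n) :
  (forall i, continuous (fun t => f t 0 i)) -> continuous f.
Proof.
move=> cf t; apply/cvg_ballP => e e0.
have : \forall s \near t, forall i : 'I_n, ball (f t 0 i) e (f s 0 i).
  by apply: filter_forall => i; have /cvg_ballP := cf i t; exact.
by apply: filterS => s hs; split => // i j; rewrite (ord1 i); exact: hs.
Qed.

Lemma continuous_subrV {R : realType} {n : nat} (a : 'rV[R]_n) :
  continuous (fun x : 'rV[R]_n => x - a).
Proof.
apply: continuous_rV => i.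
rewrite (_ : (fun _ => _) = (fun x : 'rV[R]_n => x 0 i - a 0 i)); last first.
  by apply/funext => x; rewrite !mxE.
move=> x; apply: (@continuousB _ _ _ (fun z : 'rV[R]_n => z 0 i) (cst (a 0 i))).
  exact: coord_continuous.
exact: cst_continuous.
Qed.

Section superlinear_functions.
Context {R : realType} {n : nat}.
Implicit Types (u v : 'rV[R]_n -> \bar R) (h k : 'rV[R]_n -> R) (x y : 'rV[R]_n).

Definition l1norm x : R := \sum_(i < n) `|x 0 i|.

Lemma dotv_le_l1norm x y (M : R) : (forall i, `|y 0 i| <= M) ->
  `|dotv x y| <= M * l1norm x.
Proof.
move=> yM; rewrite (le_trans (ler_norm_sum _ _ _))// mulr_sumr ler_sum// => i _.
by rewrite normrM mulrC ler_wpM2r.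
Qed.

Lemma coord_le_l1norm x i : `|x 0 i| <= l1norm x.
Proof. by rewrite /l1norm (bigD1 i)//= lerDl sumr_ge0. Qed.

Lemma l1norm_ge0 x : 0 <= l1norm x.
Proof. exact: sumr_ge0. Qed.

Lemma coord_le_enorm x i : `|x 0 i| <= enorm x.
Proof.
rewrite -sqrtr_sqr ler_wsqrtr// /dotv (bigD1 i)//= -expr2 lerDl.
by apply: sumr_ge0 => j _; rewrite -expr2 sqr_ge0.
Qed.

Lemma l1norm_le (M : R) x : (forall i, `|x 0 i| <= M) -> l1norm x <= M *+ n.
Proof.
move=> xM; apply: (le_trans (ler_sum _ (fun i _ => xM i))).
by rewrite sumr_const card_ord.
Qed.

(** The growth h x / |x| -> +oo as a family of global lower bounds.  The l1 norm
    is used because exp (- l1norm x) is a product over the coordinates. *)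
Definition superlinear h : Prop :=
  forall K : R, exists C : R, forall x, K * l1norm x - C <= h x.

Definition smooth_convex h : Prop :=
  [/\ convex_rV h, continuous h,
      forall x i, derivable h x (delta_mx 0 i)
    & forall i, continuous (partial i h)].

(** Superlinearity at infinity becomes a global bound because on a ball h is
    bounded below by its tangent at the origin. *)
Lemma classL'_real u : classL' u ->
  exists h, [/\ u = EFin \o h, smooth_convex h & superlinear h].
Proof.
move=> [[[_ cu] _ _] uT [[cfu dfu] _] _ ulim].
pose h := fine \o u.
have uE : u = EFin \o h.
  apply/funext => x; rewrite /h /= fineK//.
  by have : edom u x by rewrite uT.
have ch : convex_rV h.
  move=> x y t t01; have := cu x y t t01.
  by rewrite uE /= -!EFinM -EFinD lee_fin.
have dh x i : derivable h x (delta_mx 0 i) by have [] := dfu i.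
exists h; split=> //; first by split=> // i; have [] := dfu i.
move=> K; have /cvgeyPge/(_ (`|K| *+ n)) := ulim.
move=> [r _ hr]; pose r' := Num.max r 0.
pose G := \sum_i `|gradient h 0 0 i|.
exists (`|K| * (r' *+ n) + G * (r' *+ n) + `|h 0|) => x.
have r'0 : 0 <= r' by rewrite le_max lexx orbT.
have G0 : 0 <= G by exact: sumr_ge0.
have rn0 : 0 <= r' *+ n by rewrite mulrn_wge0.
have KE : K * l1norm x <= `|K| * l1norm x by rewrite ler_wpM2r ?l1norm_ge0 ?ler_norm.
have h0 := ler_norm (h 0).
have hN0 := ler_norm (- h 0); rewrite normrN in hN0.
have [rx|xr] := ltP r' (enorm x).
  have x0 : 0 < enorm x by apply: le_lt_trans rx.
  have /hr : r < enorm x by apply: le_lt_trans rx; rewrite le_max lexx.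
  rewrite uE /= lee_fin ler_pdivlMr// => hx.
  have Kn : `|K| * l1norm x <= `|K| *+ n * enorm x.
    rewrite mulrnAl -mulrnAr ler_wpM2l// l1norm_le// => i.
    exact: coord_le_enorm.
  have := mulr_ge0 G0 rn0; have := mulr_ge0 (normr_ge0 K) rn0.
  have := normr_ge0 (h 0); lra.
have xi i : `|x 0 i| <= r' by apply: le_trans xr; exact: coord_le_enorm.
have l1 : l1norm x <= r' *+ n by exact: l1norm_le.
have := convex_ge_gradient x ch (dh 0); rewrite subr0 dotvC.
have : `|dotv x (gradient h 0)| <= G * l1norm x.
  by apply: dotv_le_l1norm => i; rewrite -/(l1norm _) coord_le_l1norm.
rewrite dotvC ler_norml => /andP[gx _].
have := ler_wpM2l G0 l1; have := ler_wpM2l (normr_ge0 K) l1.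
lra.
Qed.

Lemma fenchel_young h y x :
  ((dotv x y - h x)%:E <= fenchel (EFin \o h) y)%E.
Proof. by apply: ereal_sup_ubound; exists x. Qed.

Lemma fenchel_fin_num h y : superlinear h -> fenchel (EFin \o h) y \is a fin_num.
Proof.
move=> /(_ (l1norm y))[C hC].
apply/fin_real/andP; split.
  by apply: lt_le_trans (fenchel_young h y 0); exact: ltNyr.
apply: (@le_lt_trans _ _ C%:E); last exact: ltry.
apply: ge_ereal_sup => _ [x _ <-] /=; rewrite lee_fin.
have := dotv_le_l1norm x (coord_le_l1norm y); rewrite ler_norml => /andP[_].
by have := hC x; lra.
Qed.

(** The supremum is attained at x: this is the gradient inequality at x. *)
Lemma fenchel_gradient h x : smooth_convex h ->
  fenchel (EFin \o h) (gradient h x) = (dotv x (gradient h x) - h x)%:E.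
Proof.
move=> [ch _ dh _]; apply/eqP; rewrite eq_le fenchel_young andbT.
apply: ge_ereal_sup => _ [y _ <-] /=; rewrite lee_fin.
have := convex_ge_gradient y ch (dh x).
by rewrite dotvBr !(dotvC (gradient h x)); lra.
Qed.

Lemma continuous_dotvr x : continuous (dotv x).
Proof.
rewrite (_ : dotv x = fun y => \sum_i x 0 i * y 0 i)//.
apply: continuous_big => [|i _ y]; first exact: add_continuous.
apply: (@continuousM _ _ (cst (x 0 i)) (fun z : 'rV[R]_n => z 0 i)).
  exact: cst_continuous.
exact: coord_continuous.
Qed.

End superlinear_functions.

(** * The infimal convolution *)

Section infconvolution.
Context {R : realType} {n : nat}.
Variables (h k : 'rV[R]_n -> R).
Implicit Types (x y z : 'rV[R]_n) (t : R).
Let u : 'rV[R]_n -> \bar R := EFin \o h.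
Let v : 'rV[R]_n -> \bar R := EFin \o k.

Lemma infconv_rscale_le t x z : 0 < t ->
  (infconv u (rscale v t) x <= (h (x - t *: z) + t * k z)%:E)%E.
Proof.
move=> t0; apply: ereal_inf_lbound; exists (t *: z) => //=.
by rewrite /rscale gt_eqF// scalerA mulVf ?gt_eqF// scale1r.
Qed.

Lemma infconv_rscale_ge t x (M : \bar R) : 0 < t ->
  (forall z, M <= (h (x - t *: z) + t * k z)%:E)%E ->
  (M <= infconv u (rscale v t) x)%E.
Proof.
move=> t0 Mz; apply: le_ereal_inf_tmp => _ [y _ <-].
have := Mz (t^-1 *: y); rewrite scalerA divff ?gt_eqF// scale1r.
by rewrite /rscale gt_eqF.
Qed.

(** An infimum of continuous functions is upper semicontinuous. *)
Lemma open_infconv_lt t (a : \bar R) : 0 < t -> continuous h ->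
  open [set x | (infconv u (rscale v t) x < a)%E].
Proof.
move=> t0 ch.
rewrite (_ : [set x | _] =
    \bigcup_z [set x | ((h (x - t *: z) + t * k z)%:E < a)%E]).
  apply: bigcup_open => z _.
  apply: (@open_comp _ _ (fun x => h (x - t *: z) + t * k z) [set y | (y%:E < a)%E]).
    move=> x _; apply: (@continuousD _ _ _ (fun x => h (x - t *: z)) (cst (t * k z))).
      apply: continuous_comp; last exact: ch.
      exact: continuous_subrV.
    exact: cst_continuous.
  exact: open_ereal_lt.
apply/seteqP; split=> x /=.
  move=> xa; apply: contrapT => xz.
  have : (a <= infconv u (rscale v t) x)%E.
    apply: infconv_rscale_ge => // z; rewrite leNgt; apply/negP => za.
    by apply: xz; exists z.
  by rewrite leNgt xa.
by move=> [z _] /=; apply: le_lt_trans; exact: infconv_rscale_le.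
Qed.

End infconvolution.

(** * Borel functions and Lebesgue measure *)

Section measurability_rV.
Context {R : realType} {n : nat}.

Lemma open_measurable_rV (U : set 'rV[R]_n) : open U -> measurable U.
Proof. by move=> oU; apply: sub_sigma_algebra. Qed.

Lemma continuous_measurable_rV (f : 'rV[R]_n -> R) :
  continuous f -> measurable_fun [set: 'rV[R]_n] f.
Proof.
move=> cf; apply: (measurability _ (RGenOpens.measurableE R)).
move=> _ [_ [a [b ->]] <-]; rewrite setTI; apply: open_measurable_rV.
by apply: open_comp; [move=> x _; exact: cf|exact: interval_open].
Qed.

Lemma lsc_measurable_rV (f : 'rV[R]_n -> \bar R) :
  (forall a, open [set x | (a < f x)%E]) -> measurable_fun [set: 'rV[R]_n] f.
Proof.
move=> fo; apply: (measurability _ (ErealGenOInfty.measurableE R)).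
move=> _ [_ [a ->] <-]; rewrite setTI; apply: open_measurable_rV.
by rewrite preimage_itvoy; exact: fo.
Qed.

Lemma usc_measurable_rV (f : 'rV[R]_n -> \bar R) :
  (forall a, open [set x | (f x < a)%E]) -> measurable_fun [set: 'rV[R]_n] f.
Proof.
move=> fo; apply: (measurability _ (ErealGenInftyO.measurableE R)).
move=> _ [_ [a ->] <-]; rewrite setTI; apply: open_measurable_rV.
by rewrite preimage_itvNyo; exact: fo.
Qed.

End measurability_rV.

Section integral_rV.
Local Open Scope ereal_scope.
Context {R : realType}.

Lemma ge0_integral_lebesgue_rVS n (F : 'rV[R]_n.+1 -> \bar R) :
  measurable_fun setT F -> (forall x, 0 <= F x) ->
  \int[lebesgue_rV R n.+1]_x F x =
  \int[lebesgue_measure]_s \int[lebesgue_rV R n]_y F (rV_cons (s, y)).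
Proof.
move=> mF F0.
transitivity (\int[lebesgue_measure \x lebesgue_rV R n]_p F (rV_cons p)).
  rewrite (_ : \int[lebesgue_rV R n.+1]_x F x =
    \int[pushforward (lebesgue_measure \x lebesgue_rV R n) (@rV_cons R n)]_x F x)//.
  have mcons : measurable_fun [set: measurableTypeR R * 'rV[R]_n]
    (@rV_cons R n : measurableTypeR R * 'rV[R]_n -> _) by exact: measurable_rV_cons.
  by rewrite (ge0_integral_pushforward mcons).
have := @fubini_tonelli1 _ _ (measurableTypeR R) 'rV[R]_n R lebesgue_measure
  (lebesgue_rV R n) (F \o @rV_cons R n : measurableTypeR R * 'rV[R]_n -> _).
move=> FT; apply: FT => [|p]; last exact: F0.
by apply: measurableT_comp => //; exact: measurable_rV_cons.
Qed.

Lemma ge0_integral_lebesgue_affine (b r : R) (F : R -> \bar R) : (0 < r)%R ->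
  measurable_fun setT F -> (forall x, 0 <= F x) ->
  \int[lebesgue_measure]_s F (b + r * s)%R = (r^-1)%:E * \int[lebesgue_measure]_s F s.
Proof.
move=> r0 mF F0; pose phi (s : measurableTypeR R) : measurableTypeR R := (b + r * s)%R.
have mphi : measurable_fun setT phi.
  by apply: measurable_funD => //; exact: measurable_funM.
pose rnn := NngNum (ltW r0).
pose nu : {measure set (measurableTypeR R) -> \bar R} :=
  mscale rnn (measure_function_pushforward__canonical__measure_function_Measure
    lebesgue_measure mphi).
have -> : \int[lebesgue_measure]_s F s = \int[nu]_s F s.
  apply: (@eq_measure_integral _ (measurableTypeR R) R setT nu) => A mA _.
  apply: lebesgue_measure_unique => //.
  move=> _ [[c d]] _ <-.
  have preE : (phi @^-1` `]c, d] = `](c - b) / r, (d - b) / r]%classic)%R.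
    apply/seteqP; split=> x /=; rewrite !in_itv/= ltr_pdivrMr// ler_pdivlMr//;
      by rewrite ltrBlDl lerBrDl (mulrC x).
  transitivity (r%:E * lebesgue_measure (phi @^-1` `]c, d]%classic)); last by [].
  rewrite preE.
  rewrite !lebesgue_measure_itv/= !lte_fin ltr_pM2r ?invr_gt0// ltrD2r.
  case: ifPn => _; last by rewrite mule0.
  by rewrite -!EFinB -EFinM; congr EFin; field; rewrite gt_eqF.
rewrite ge0_integral_mscale// ge0_integral_pushforward//.
by rewrite muleA -EFinM mulVf ?gt_eqF// mul1e.
Qed.

(** Slicing along the first coordinate reduces the claim to the line, where it
    holds on intervals and hence for all Borel sets. *)
Lemma ge0_integral_affine_rV n (b : 'rV[R]_n) (r : R) (F : 'rV[R]_n -> \bar R) :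
  (0 < r)%R -> measurable_fun setT F -> (forall x, 0 <= F x) ->
  \int[lebesgue_rV R n]_x F (b + r *: x)%R =
  (r ^- n)%:E * \int[lebesgue_rV R n]_x F x.
Proof.
move=> r0; elim: n b F => [|n IH] b F mF F0.
  by rewrite expr0 invr1 mul1e; apply: eq_integral => x _; congr F; apply/rowP => -[].
have maff (m : nat) (c : 'rV[R]_m) :
    measurable_fun setT (fun x : 'rV[R]_m => c + r *: x)%R.
  apply: measurable_fun_rV => i; under eq_fun do rewrite !mxE.
  apply: measurable_funD => //; apply: measurable_funM => //.
  exact: measurable_rV_coord.
pose b' : 'rV[R]_n := \row_i b 0%R (lift ord0 i).
have mG : measurable_fun setT (fun p : R * 'rV[R]_n => F (rV_cons p)).
  by apply: measurableT_comp => //; exact: measurable_rV_cons.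
have mGs s : measurable_fun setT (fun y : 'rV[R]_n => F (rV_cons (s, y))).
  apply: (measurableT_comp mG) => /=; exact: measurable_pair1.
rewrite ge0_integral_lebesgue_rVS//; last exact: measurableT_comp.
have consE s (y : 'rV[R]_n) :
    (b + r *: rV_cons (s, y) = rV_cons (b 0 ord0 + r * s, b' + r *: y))%R.
  by apply/rowP => i; rewrite !mxE; case: unliftP => [j|] ->; rewrite ?mxE.
transitivity (\int[lebesgue_measure]_s ((r ^- n)%:E *
    \int[lebesgue_rV R n]_y F (rV_cons (b 0%R ord0 + r * s, y)%R))).
  apply: eq_integral => s _; rewrite -(IH b')//.
  by apply: eq_integral => y _; rewrite consE.
have mI : measurable_fun setT
    (fun s => \int[lebesgue_rV R n]_y F (rV_cons (s, y))).
  exact: (measurable_fun_fubini_tonelli_F (fun p => F (rV_cons p))).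
have I0 s : 0 <= \int[lebesgue_rV R n]_y F (rV_cons (s, y)).
  by apply: integral_ge0 => y _.
have maff1 : measurable_fun setT (fun s : measurableTypeR R => b 0%R ord0 + r * s)%R.
  by apply: measurable_funD => //; exact: measurable_funM.
rewrite ge0_integralZl_EFin//; last 2 first.
- exact: (measurableT_comp mI maff1).
- by rewrite invr_ge0 exprn_ge0 ?ltW.
rewrite (ge0_integral_lebesgue_affine (b 0%R ord0) r0 mI I0) muleA -EFinM.
by rewrite -ge0_integral_lebesgue_rVS// exprSr invfM.
Qed.

End integral_rV.

(** * Images of measures with a density *)

Section density_pushforward.
Local Open Scope ereal_scope.
Context d d' (X : measurableType d) (Y : measurableType d') (R : realType).
Variables (mu : {measure set X -> \bar R}) (f : X -> R) (phi : X -> Y).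
Hypotheses (mf : measurable_fun setT f) (f0 : forall x, (0 <= f x)%R).
Hypothesis mphi : measurable_fun setT phi.

Definition density_pushforward (A : set Y) : \bar R :=
  \int[mu]_(x in phi @^-1` A) (f x)%:E.
Local Notation nu := density_pushforward.

Let mpre A : measurable A -> measurable (phi @^-1` A).
Proof. by move=> mA; rewrite -[X in measurable X]setTI; exact: mphi. Qed.

Let mEf D : measurable_fun D (EFin \o f).
Proof. by apply/measurable_EFinP; exact: measurable_funTS. Qed.

Let nu0 : nu set0 = 0.
Proof. by rewrite /nu preimage_set0 integral_set0. Qed.

Let nu_ge0 A : 0 <= nu A.
Proof. by apply: integral_ge0 => x _; rewrite lee_fin. Qed.

Let nu_sigma_additive : semi_sigma_additive nu.
Proof.
move=> F mF tF mUF.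
have mpF k : measurable (phi @^-1` F k) by exact: mpre.
have f0' x : (\bigcup_k (phi @^-1` F k)) x -> 0 <= (f x)%:E by rewrite lee_fin.
have tpF : trivIset setT (fun k => phi @^-1` F k).
  apply/trivIsetP => /= i j _ _ ij; rewrite -preimage_setI.
  by move/trivIsetP : tF => /(_ _ _ _ _ ij) ->//; rewrite preimage_set0.
rewrite [X in _ --> X](_ : _ = \sum_(i <oo) nu (F i)); last first.
  rewrite /nu preimage_bigcup.
  by rewrite ge0_integral_bigcup//; exact: mEf.
by apply: is_cvg_nneseries => n _ _; exact: nu_ge0.
Qed.

HB.instance Definition _ := isMeasure.Build _ _ _ nu nu0 nu_ge0 nu_sigma_additive.

Import HBNNSimple.

Lemma ge0_integral_density_pushforward (h : Y -> \bar R) :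
  measurable_fun setT h -> (forall y, 0 <= h y) ->
  \int[nu]_y h y = \int[mu]_x (h (phi x) * (f x)%:E).
Proof.
move=> mh h0; pose g := nnsfun_approx measurableT mh.
have gh y : h y = limn (fun n => (g n y)%:E).
  by apply/esym/cvg_lim => //; exact: cvg_nnsfun_approx.
have mg n : measurable_fun setT (fun y => (g n y)%:E).
  by apply/measurable_EFinP.
transitivity (limn (fun n => \int[nu]_y (g n y)%:E)).
  rewrite (eq_integral (fun y => limn (fun n => (g n y)%:E)))//.
  apply: monotone_convergence => //.
  - by move=> n y _; rewrite lee_fin.
  - by move=> y _ a b ab; rewrite lee_fin; exact/lefP/nd_nnsfun_approx.
have -> : \int[mu]_x (h (phi x) * (f x)%:E) =
    limn (fun n => \int[mu]_x ((g n (phi x))%:E * (f x)%:E)).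
  rewrite (eq_integral (fun x => limn (fun n => (g n (phi x))%:E * (f x)%:E)));
    last first.
    move=> x _; apply/esym/cvg_lim => //; apply: cvgeZr => //.
    by apply: cvg_nnsfun_approx.
  apply: monotone_convergence => //.
  - move=> n; apply: emeasurable_funM; last exact: mEf.
    exact: (measurableT_comp (mg n)).
  - by move=> n x _; rewrite mule_ge0// lee_fin.
  - move=> x _ a b ab; rewrite lee_wpmul2r// lee_fin//.
    exact/lefP/nd_nnsfun_approx.
congr (limn _); apply/funext => n.
have mind r : measurable_fun setT (fun y => (r * \1_(g n @^-1` [set r]) y)%:E).
  by apply/measurable_EFinP; exact: measurable_funM.
rewrite (eq_integral (fun y =>
  \sum_(r \in range (g n)) (r * \1_(g n @^-1` [set r]) y)%:E)); last first.
  by move=> y _; rewrite fimfunE -fsumEFin.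
rewrite ge0_integral_fsum//; last by move=> r y _; exact: nnfun_muleindic_ge0.
rewrite [RHS](eq_integral (fun x => \sum_(r \in range (g n))
    ((r * \1_(g n @^-1` [set r]) (phi x))%:E * (f x)%:E))); last first.
  move=> x _; rewrite fimfunE -fsumEFin// ge0_mule_fsuml// => r.
  exact: nnfun_muleindic_ge0.
rewrite ge0_integral_fsum//; last 2 first.
- move=> r; apply: emeasurable_funM; last exact: mEf.
  exact: (measurableT_comp (mind r)).
- by move=> r x _; rewrite mule_ge0 ?lee_fin//; exact: nnfun_muleindic_ge0.
apply: eq_fsbigr => r _.
have [r0|r0] := ltP r 0%R.
  rewrite preimage_nnfun0//; under eq_integral do rewrite indic0 mulr0.
  rewrite integral0; apply/esym.
  by under eq_integral do rewrite indic0 mulr0 mul0e; rewrite integral0.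
under eq_integral do rewrite EFinM.
rewrite ge0_integralZl_EFin//; last exact/measurable_EFinP.
rewrite integral_indic// setIT.
under [RHS]eq_integral do rewrite EFinM -muleA.
rewrite ge0_integralZl_EFin//; last 2 first.
- by move=> y _; rewrite mule_ge0 // lee_fin.
- apply: emeasurable_funM; last exact: mEf.
  by apply: (measurableT_comp (f := EFin \o \1__)) => //; apply/measurable_EFinP.
congr (_ * _).
transitivity (\int[mu]_(x in phi @^-1` (g n @^-1` [set r])) (f x)%:E); first by [].
rewrite integral_mkcond; apply: eq_integral => x _.
rewrite patchE indicE /preimage/=.
case: ifPn => [xA|xA].
  by rewrite mem_set ?mul1e//; move: xA; rewrite inE.
by rewrite memNset ?mul0e//; move/negP: xA; rewrite inE.
Qed.

Lemma integral_density_pushforward (h : Y -> \bar R) :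
  measurable_fun setT h ->
  \int[nu]_y h y = \int[mu]_x (h (phi x) * (f x)%:E).
Proof.
have max0M (a : \bar R) (c : R) : (0 <= c)%R -> maxe a 0 * c%:E = maxe (a * c%:E) 0.
  move=> c0; have [a0|a0] := leP a 0.
    by rewrite mul0e; apply/esym/max_idPr/mule_le0_ge0; rewrite ?lee_fin.
  by apply/esym/max_idPl/mule_ge0; [exact: ltW|rewrite lee_fin].
move=> mh; have mp : measurable_fun setT h^\+ by exact/measurable_funepos.
have mn : measurable_fun setT h^\- by exact/measurable_funeneg.
rewrite (integralE nu) !ge0_integral_density_pushforward//.
rewrite [in RHS]integralE; congr (_ - _); apply: eq_integral => x _.
  by rewrite !funeposE max0M.
by rewrite !funenegE -mulNe max0M.
Qed.

End density_pushforward.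

(** * Convergence of integrals under convergent majorants *)

Section pratt.
Local Open Scope ereal_scope.
Context d (T : measurableType d) (R : realType).
Variable mu : {measure set T -> \bar R}.

(** Fatou's lemma without a limit inferior: a bound below the integral of the
    limit is eventually a bound below the integrals. *)
Lemma fatou_near (g : nat -> T -> R) (g0 : T -> R) (a : R) :
  (forall n, measurable_fun setT (g n)) -> (forall n x, (0 <= g n x)%R) ->
  (forall x, g n x @[n --> \oo] --> g0 x) ->
  (a%:E < \int[mu]_x (g0 x)%:E) ->
  \forall n \near \oo, a%:E < \int[mu]_x (g n x)%:E.
Proof.
move=> mg g_ge0 gcvg ag.
pose I n := \int[mu]_x (g n x)%:E.
have : \int[mu]_x (g0 x)%:E <= limn_einf I.
  have := @fatou _ _ _ mu setT measurableT (fun n x => (g n x)%:E).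
  rewrite (eq_integral (fun x => (g0 x)%:E)).
    by apply=> [n|n x _]; [exact/measurable_EFinP|rewrite lee_fin].
  move=> x _; apply: (cvg_limn_einf_sup _).1.
  by apply: cvg_EFin; [exact: nearW|exact: gcvg].
rewrite limn_einf_lim => /(lt_le_trans ag) aI.
have /(_ _ (open_ereal_gt' aI)) := @is_cvg_einfs R I.
move=> [N _ HN]; exists N => // n Nn.
apply: (lt_le_trans (HN n Nn)).
by apply: ereal_inf_lbound; exists n => /=.
Qed.

(** Fatou's lemma applied to g bounds the integrals of g asymptotically from
    below, and applied to G - g it bounds them from above, since the integrals
    of G converge. *)
Lemma pratt_convergence (g G : nat -> T -> R) (g0 G0 : T -> R) :
  (forall n, measurable_fun setT (g n)) ->
  (forall n x, (0 <= g n x <= G n x)%R) ->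
  (forall x, g n x @[n --> \oo] --> g0 x) ->
  (forall x, G n x @[n --> \oo] --> G0 x) ->
  (forall n, mu.-integrable setT (EFin \o G n)) ->
  mu.-integrable setT (EFin \o G0) ->
  \int[mu]_x (G n x)%:E @[n --> \oo] --> \int[mu]_x (G0 x)%:E ->
  mu.-integrable setT (EFin \o g0) /\
  \int[mu]_x (g n x)%:E @[n --> \oo] --> \int[mu]_x (g0 x)%:E.
Proof.
move=> mg gG gcvg Gcvg iG iG0 IGcvg.
have g_ge0 n x : (0 <= g n x)%R by have /andP[] := gG n x.
have g0_ge0 x : (0 <= g0 x)%R.
  by apply: (cvgr_to_ge (gcvg x)); apply: nearW.
have g0G0 x : (g0 x <= G0 x)%R.
  apply: (ler_cvg_to (gcvg x) (Gcvg x)); apply: nearW => n.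
  by have /andP[] := gG n x.
have mg0 : measurable_fun setT g0 by apply: (measurable_fun_cvg mg) => x _.
have ig0 : mu.-integrable setT (EFin \o g0).
  apply: (le_integrable _ _ _ iG0) => //; first exact/measurable_EFinP.
  by move=> x _; rewrite /= lee_fin ger0_norm// ger0_norm// (le_trans _ (g0G0 x)).
have ig n : mu.-integrable setT (EFin \o g n).
  apply: (le_integrable _ _ _ (iG n)) => //; first exact/measurable_EFinP.
  move=> x _; have /andP[h1 h2] := gG n x.
  by rewrite /= lee_fin ger0_norm// ger0_norm// (le_trans _ h2).
split=> //.
have fin h : mu.-integrable setT (EFin \o h) ->
    exists r : R, \int[mu]_x (h x)%:E = r%:E.
  move=> ih; exists (fine (\int[mu]_x (h x)%:E)); rewrite fineK//.
  exact: (integrable_fin_num _ ih).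
have [a aE] := fin _ ig0; have [b bE] := fin _ iG0.
have /choice[an anE] := fun n => fin _ (ig n).
have /choice[bn bnE] := fun n => fin _ (iG n).
have baE : \int[mu]_x (G0 x - g0 x)%:E = (b - a)%:E.
  by rewrite integralB_EFin// aE bE.
have baEn n : \int[mu]_x (G n x - g n x)%:E = (bn n - an n)%:E.
  by rewrite integralB_EFin// anE bnE.
rewrite aE; under eq_cvg do rewrite anE.
rewrite bE in IGcvg.
have {}IGcvg : bn n @[n --> \oo] --> b.
  rewrite (_ : bn = fine \o (fun n => \int[mu]_x (G n x)%:E)).
    exact: fine_cvg IGcvg.
  by apply/funext => n; rewrite /= bnE.
apply: cvg_EFin; first exact: nearW.
suff : forall e : R, (0 < e)%R -> \forall n \near \oo, (`|a - an n| <= e)%R.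
  by move=> near_a; apply/cvgrPdist_le => e; exact: near_a.
move=> e e0; have e20 : (0 < e / 2)%R by rewrite divr_gt0.
have lowg : \forall n \near \oo, (a - e / 2)%:E < \int[mu]_x (g n x)%:E.
  by apply: (fatou_near (g0 := g0)) => //; rewrite aE lte_fin; lra.
have lowG : \forall n \near \oo, (b - a - e / 2)%:E < \int[mu]_x (G n x - g n x)%:E.
  apply: (fatou_near (g0 := G0 \- g0)%R) => //.
  - move=> n; apply: measurable_funB => //; apply/measurable_EFinP.
    exact: measurable_int (iG n).
  - by move=> n x; have /andP[_] := gG n x; rewrite subr_ge0.
  - by move=> x; apply: cvgB.
  - by rewrite baE lte_fin; lra.
move/cvgrPdist_le : IGcvg => /(_ _ e20) bcvg.
near=> n.
have h1 : (a - e / 2)%:E < \int[mu]_x (g n x)%:E by near: n.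
have h2 : (b - a - e / 2)%:E < \int[mu]_x (G n x - g n x)%:E by near: n.
have h3 : (`|b - bn n| <= e / 2)%R by near: n.
move: h1 h2 h3; rewrite anE baEn !lte_fin !ler_norml => h1 h2 /andP[h3 h4].
by apply/andP; split; lra.
Unshelve. all: by end_near. Qed.

End pratt.

(** * Integrability of exp (- h) *)

Section exponential_integrability.
Local Open Scope ereal_scope.
Context {R : realType}.

Lemma integral_expRN_norm_lty :
  \int[lebesgue_measure]_s (expR (- `|s|))%:E < +oo :> \bar R.
Proof.
pose p : R -> \bar R := fun s => (exponential_pdf 1 s)%:E.
have mp : measurable_fun setT p.
  by apply/measurable_EFinP; exact: measurable_exponential_pdf.
have pdf0 (s : R) : (0 <= exponential_pdf 1 s)%R by exact: exponential_pdf_ge0.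
have bound (s : R) :
    (expR (- `|s|) <= exponential_pdf 1 s + exponential_pdf 1 (- s))%R.
  have := pdf0 s; have := pdf0 (- s)%R; have [s0|s0] := leP 0%R s.
    by rewrite (exponential_pdfE _ s0) ger0_norm// mulN1r mul1r; lra.
  have sN : (0 <= - s)%R by rewrite oppr_ge0 ltW.
  by rewrite (exponential_pdfE _ sN) ltr0_norm// mulN1r mul1r; lra.
have p0 s : 0 <= p s by rewrite lee_fin.
have opp : measurable_fun setT (-%R : measurableTypeR R -> measurableTypeR R).
  exact: oppr_measurable.
have pN : \int[lebesgue_measure]_s p (- s)%R = \int[lebesgue_measure]_s p s.
  pose nu : {measure set (measurableTypeR R) -> \bar R} :=
    measure_function_pushforward__canonical__measure_function_Measure
      lebesgue_measure opp.
  have <- : \int[nu]_s p s = \int[lebesgue_measure]_s p s.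
    apply: (@eq_measure_integral _ (measurableTypeR R) R setT lebesgue_measure).
    by move=> A mA _; exact: lebesgue_measureN.
  by rewrite /nu (ge0_integral_pushforward opp).
have pE : \int[lebesgue_measure]_s p s = 1 by exact: integral_exponential_pdf.
apply: (@le_lt_trans _ _ (\int[lebesgue_measure]_s (p s + p (- s)%R))).
  apply: ge0_le_integral => //.
  - apply/measurable_EFinP; apply: (measurableT_comp (f := expR)) => //.
    by apply: measurable_funN; exact: normr_measurable.
  - by apply: emeasurable_funD => //; exact: (measurableT_comp mp).
  - by move=> s _; rewrite /p -EFinD lee_fin; exact: bound.
rewrite ge0_integralD//; last exact: (measurableT_comp mp).
by rewrite pN pE -EFinD ltry.
Qed.

Lemma continuous_l1norm n : continuous (@l1norm R n).
Proof.
apply: continuous_big => [|i _ x]; first exact: add_continuous.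
by apply: continuous_comp; [exact: coord_continuous|exact: norm_continuous].
Qed.

Lemma continuous_expRN n (h : 'rV[R]_n -> R) :
  continuous h -> continuous (fun x => expR (- h x)).
Proof.
move=> ch x; apply: continuous_comp; last exact: continuous_expR.
by apply: (@continuousN _ R^o); exact: ch.
Qed.

Lemma integral_expRN_l1norm_lty n :
  \int[lebesgue_rV R n]_x (expR (- l1norm x))%:E < +oo.
Proof.
have mexp m : measurable_fun setT (fun x : 'rV[R]_m => (expR (- l1norm x))%:E).
  apply/measurable_EFinP; apply: continuous_measurable_rV.
  exact: continuous_expRN (@continuous_l1norm _).
elim: n => [|n IH].
  rewrite (_ : \int[lebesgue_rV R 0]_x _ =
      \int[dirac (0%R : 'rV[R]_0)]_x (expR (- l1norm x))%:E)//.
  rewrite integral_dirac => [||]; [|exact: measurableT|exact: mexp].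
  by rewrite diracT mul1e ltry.
rewrite (ge0_integral_lebesgue_rVS (mexp _)) => [|x]; last by rewrite lee_fin expR_ge0.
have l1cons s (y : 'rV[R]_n) : l1norm (rV_cons (s, y)) = (`|s| + l1norm y)%R.
  rewrite /l1norm big_ord_recl mxE unlift_none/=; congr (_ + _)%R.
  by apply: eq_bigr => i _; rewrite mxE liftK.
set I := \int[lebesgue_rV R n]_x (expR (- l1norm x))%:E in IH *.
have I0 : 0 <= I by apply: integral_ge0 => x _; rewrite lee_fin expR_ge0.
rewrite (eq_integral (fun s : measurableTypeR R => (expR (- `|s : R|))%:E * I));
  last first.
  move=> s _; rewrite -ge0_integralZl_EFin ?expR_ge0//.
  by apply: eq_integral => y _; rewrite l1cons opprD expRD.
have mI : measurable_fun setT (fun s : R => (expR (- `|s|))%:E).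
  apply/measurable_EFinP; apply: (measurableT_comp (f := expR)).
    exact: measurable_expR.
  by apply: measurable_funN; exact: normr_measurable.
have e0 : 0 <= \int[lebesgue_measure]_s (expR (- `|s|))%:E :> \bar R.
  by apply: integral_ge0 => s _; rewrite lee_fin expR_ge0.
rewrite ge0_integralZr// lte_mul_pinfty//.
by rewrite ge0_fin_numE// integral_expRN_norm_lty.
Qed.

Lemma integrable_expRN_superlinear n (h : 'rV[R]_n -> R) :
  continuous h -> superlinear h ->
  (lebesgue_rV R n).-integrable setT (fun x => (expR (- h x))%:E).
Proof.
move=> ch /(_ 1%R)[C hC].
have il : (lebesgue_rV R n).-integrable setT (fun x => (expR (- l1norm x))%:E).
  apply/integrableP; split.
    apply/measurable_EFinP; apply: continuous_measurable_rV.
    exact: continuous_expRN (@continuous_l1norm _).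
  under eq_integral do rewrite /= ger0_norm ?expR_ge0//.
  exact: integral_expRN_l1norm_lty.
apply: le_integrable (integrableZl measurableT (expR C) il) => //.
  apply/measurable_EFinP; apply: continuous_measurable_rV.
  exact: continuous_expRN.
move=> x _; rewrite /= lee_fin -expRD !ger0_norm ?expR_ge0// ler_expR.
by have := hC x; lra.
Qed.

End exponential_integrability.

(** * Integration by parts along dilations *)

Section dilation.
Context {R : realType}.

Lemma FTC_is_derive (F f : R -> R) (a b : R) : a < b ->
  (forall x, is_derive x (1 : R) F (f x)) -> continuous f ->
  (\int[lebesgue_measure]_(x in `[a, b]) (f x)%:E = (F b - F a)%:E)%E.
Proof.
move=> ab dF cf.
have dFx x : derivable F x 1 by exact: ex_derive.
have cF x : {for x, continuous F}.
  by apply: differentiable_continuous; apply/derivable1_diffP.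
rewrite (@continuous_FTC2 _ f F)//.
- exact: continuous_subspaceT.
- split; first by move=> x _; exact: dFx.
  - by apply: cvg_at_right_filter; exact: cF.
  - by apply: cvg_at_left_filter; exact: cF.
- by move=> x _; rewrite derive1E; apply: derive_val.
Qed.

Lemma is_derive_expRN (G : R -> R) (t g : R) : is_derive t (1 : R) G g ->
  is_derive t (1 : R) (fun s => expR (- G s)) (- g * expR (- G t)).
Proof.
move=> dG.
have dN : is_derive t (1 : R) (fun s => - G s) (- g) by exact: is_deriveN.
have -> : - g * expR (- G t) = expR (- G t) * - g by rewrite mulrC.
exact: (@is_derive1_comp _ expR (fun s => - G s) t _ _ (is_derive_expR _) dN).
Qed.

End dilation.

Section integration_by_parts.
Context {R : realType} {n : nat}.
Variables (h : 'rV[R]_n -> R) (a : 'rV[R]_n).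
Hypotheses (sh : smooth_convex h) (slh : superlinear h).
Local Notation mu := (lebesgue_rV R n).

Lemma continuous_radial_derivative :
  continuous (fun x : 'rV[R]_n => dotv (x - a) (gradient h x)).
Proof.
have [_ _ _ ch'] := sh.
apply: continuous_big => [|i _ x]; first exact: add_continuous.
rewrite (_ : (fun _ => _) = (fun x : 'rV[R]_n => (x - a) 0 i) \* partial i h);
  last first.
  by apply/funext => y /=; rewrite !mxE.
apply: continuousM; last exact: ch'.
apply: (@continuous_comp _ _ _ (fun y : 'rV[R]_n => y - a) (fun z => z 0 i)).
  exact: continuous_subrV.
exact: coord_continuous.
Qed.

Lemma superlinear_bounded_below : exists m, forall x, m <= h x.
Proof. by have [C hC] := slh 0; exists (- C) => x; have := hC x; lra. Qed.

(** The gradient inequality at x, evaluated at the centre a.  It makes the radial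
    derivative bounded below, so that a shift by a constant makes it nonnegative
    and the Tonelli theorem applies. *)
Lemma radial_derivative_ge x : h x - h a <= dotv (x - a) (gradient h x).
Proof.
have [ch _ dh _] := sh; have := convex_ge_gradient a ch (dh x).
by rewrite dotvC -opprB dotvNl; lra.
Qed.

(** With the scale factor written as exp t, the derivative at t of the function
    along the dilations is again a function evaluated at the dilated point.  The
    factor exp (- N t) adds N to the radial derivative. *)
Lemma is_derive_dilation (N t : R) (x : 'rV[R]_n) :
  let y := a + expR t *: (x - a) in
  is_derive t (1 : R)
    (fun s => - expR (- (N * s + h (a + expR s *: (x - a)))))
    ((N + dotv (y - a) (gradient h y)) * expR (- (N * t + h y))).
Proof.
move=> y; have [ch _ dh _] := sh.
have dl := is_derive_line a (x - a) (expR t) ch dh.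
have dc : is_derive t (1 : R) (fun s => h (a + expR s *: (x - a)))
    (dotv (gradient h y) (x - a) * expR t).
  exact: (@is_derive1_comp _ (fun s => h (a + s *: (x - a))) expR).
have dN : is_derive t (1 : R) (fun s => N * s) N.
  by apply: is_derive_eq; rewrite /GRing.scale/= mulr1.
have dG : is_derive t (1 : R) (fun s => N * s + h (a + expR s *: (x - a)))
    (N + dotv (gradient h y) (x - a) * expR t).
  exact: is_deriveD.
apply: (is_derive_eq (is_deriveN (is_derive_expRN dG))).
have -> : y - a = expR t *: (x - a) by rewrite /y addrC addKr.
by rewrite mulNr opprK dotvZl dotvC (mulrC (expR t)).
Qed.

Lemma continuous_dilation (x : 'rV[R]_n) :
  continuous (fun t : R => a + expR t *: (x - a)).
Proof.
apply: continuous_rV => i.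
rewrite (_ : (fun _ => _) = (fun t : R => a 0 i + expR t * (x - a) 0 i)); last first.
  by apply/funext => t; rewrite !mxE.
move=> t; apply: (@continuousD _ R^o _ (cst (a 0 i)) (fun t => expR t * (x - a) 0 i)).
  exact: cst_continuous.
apply: (@continuousM _ _ expR (cst ((x - a) 0 i))); last exact: cst_continuous.
exact: continuous_expR.
Qed.

Let f x := expR (- h x).
Let D (x : 'rV[R]_n) := dotv (x - a) (gradient h x).

Lemma integral_dilation (F : 'rV[R]_n -> R) (t : R) :
  measurable_fun setT F -> (forall x, 0 <= F x) ->
  (\int[mu]_x (F (a + expR t *: (x - a)))%:E =
   (expR (- (n%:R * t)))%:E * \int[mu]_x (F x)%:E)%E.
Proof.
move=> mF F0.
have := @ge0_integral_affine_rV R n (a - expR t *: a) (expR t) (EFin \o F)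
  (expR_gt0 t).
rewrite -expRM_natl -expRN => <- => [||x].
- apply: eq_integral => x _ /=; congr (F _)%:E.
  by apply/rowP => i; rewrite !mxE; ring.
- exact/measurable_EFinP.
- by rewrite lee_fin.
Qed.

(** Let q = (N + D) f with N so large that q >= 0, and let x_t be the image of x
    under the dilation with centre a and factor exp t.  Along t in [0, 1] the
    integral of exp (- N t) q x_t is f x - exp (- N) f x_1.  Integrated over x,
    both sides scale by powers of exp t: with M = N + n the Tonelli theorem gives
    (1 - exp (- M)) / M times the integral of q on one side and
    (1 - exp (- M)) times the integral of f on the other. *)
Lemma integral_radial_derivative :
  mu.-integrable setT (fun x => (D x * f x)%:E) /\
  (\int[mu]_x (D x * f x)%:E = n%:R%:E * \int[mu]_x (f x)%:E)%E.
Proof.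
have [ch cth dh _] := sh; have [m hm] := superlinear_bounded_below.
pose N := `|m| + `|h a| + 1; pose M := N + n%:R.
have N0 : 0 < N by rewrite ltr_wpDl// addr_ge0.
have M0 : 0 < M by rewrite ltr_wpDr.
pose q x := (N + D x) * f x.
have f0 x : 0 <= f x by exact: expR_ge0.
have cf : continuous f by exact: continuous_expRN.
have q0 x : 0 <= q x.
  rewrite mulr_ge0//; have := radial_derivative_ge x; have := hm x.
  have := ler_norm (h a); have := ler_norm (- m).
  by rewrite normrN /D /N; lra.
have cq : continuous q.
  move=> x; apply: (@continuousM _ _ (cst N \+ D) f); last exact: cf.
  apply: (@continuousD _ R^o _ (cst N) D); first exact: cst_continuous.
  exact: continuous_radial_derivative.
have mq : measurable_fun setT q by exact: continuous_measurable_rV.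
have mf : measurable_fun setT f by exact: continuous_measurable_rV.
have fi : mu.-integrable setT (EFin \o f) by exact: integrable_expRN_superlinear.
have [j jE] : exists j : R, (\int[mu]_x (f x)%:E = j%:E)%E.
  exists (fine (\int[mu]_x (f x)%:E)%E); rewrite fineK//.
  exact: integrable_fin_num fi.
pose xi t x : 'rV[R]_n := a + expR t *: (x - a).
pose F (p : measurableTypeR R * 'rV[R]_n) : \bar R :=
  (\1_(`[0%R, 1%R]%classic : set R) p.1 * (expR (- (N * p.1)) * q (xi p.1 p.2)))%:E.
have F0 p : (0 <= F p)%E by rewrite lee_fin indicE mulr_ge0// mulr_ge0 ?expR_ge0.
have mxi : measurable_fun setT (fun p : measurableTypeR R * 'rV[R]_n => xi p.1 p.2).
  apply: measurable_fun_rV => i; under eq_fun do rewrite !mxE.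
  apply: measurable_funD => //; apply: measurable_funM.
    exact: (measurableT_comp (f := expR)).
  apply: measurable_funB => //.
  exact: (measurableT_comp (measurable_rV_coord i) measurable_snd).
have mF : measurable_fun setT F.
  apply/measurable_EFinP; apply: measurable_funM.
    exact: (measurableT_comp (measurable_indic _) measurable_fst).
  apply: measurable_funM; last exact: (measurableT_comp mq mxi).
  apply: (measurableT_comp (f := expR)) => //; apply: measurable_funN.
  by apply: measurable_funM => //; exact: measurable_fst.
have innerx t : (\int[mu]_x F (t, x) = (\1_(`[0%R, 1%R]%classic : set R) t *
    expR (- (M * t)))%:E * \int[mu]_x (q x)%:E)%E.
  have e0 : 0 <= \1_(`[0%R, 1%R]%classic : set R) t * expR (- (N * t)).
    by rewrite indicE mulr_ge0// expR_ge0.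
  rewrite (eq_integral (fun x => (\1_(`[0%R, 1%R]%classic : set R) t *
    expR (- (N * t)))%:E * (q (xi t x))%:E)%E); last first.
    by move=> x _; rewrite /F -EFinM mulrA.
  have mqt : measurable_fun setT (fun x => (q (xi t x))%:E).
    apply/measurable_EFinP; apply: (measurableT_comp mq).
    exact: (measurableT_comp mxi (measurable_pair1 t)).
  rewrite ge0_integralZl_EFin//; last by move=> x _; rewrite lee_fin.
  rewrite integral_dilation// muleA -EFinM -mulrA -expRD; congr ((_ * expR _)%:E * _)%E.
  by rewrite /M; ring.
have K0 : (0 <= \int[mu]_x (q x)%:E)%E by apply: integral_ge0 => x _; rewrite lee_fin.
have expM : (\int[lebesgue_measure]_t (\1_(`[0%R, 1%R]%classic : set R) t *
    expR (- (M * t)))%:E = ((1 - expR (- M)) / M)%:E)%E.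
  transitivity (\int[lebesgue_measure]_(t in `[0%R, 1%R]) (expR (- (M * t)))%:E)%E.
    rewrite [RHS]integral_mkcond; apply: eq_integral => t _.
    by rewrite patchE indicE; case: ifPn => _; rewrite ?mul1r ?mul0r.
  have dE t : is_derive t (1 : R) (fun s => - M^-1 * expR (- (M * s)))
      (expR (- (M * t))).
    have dM : is_derive t (1 : R) (fun s => M * s) M.
      by apply: is_derive_eq; rewrite /GRing.scale/= mulr1.
    have dZ := is_deriveZ (- M^-1) (is_derive_expRN dM).
    apply: (is_derive_eq dZ).
    by rewrite /GRing.scale/= !mulrA mulrNN mulVf ?mul1r ?gt_eqF.
  rewrite (FTC_is_derive ltr01 dE); last first.
    by move=> t; apply: differentiable_continuous; apply/derivable1_diffP.
  by congr EFin; rewrite mulr1 mulr0 oppr0 expR0; field; rewrite gt_eqF.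
have innert x : (\int[lebesgue_measure]_t F (t, x) =
    (f x - expR (- N) * f (xi 1 x))%:E)%E.
  transitivity (\int[lebesgue_measure]_(t in `[0%R, 1%R])
      (expR (- (N * t)) * q (xi t x))%:E)%E.
    rewrite [RHS]integral_mkcond; apply: eq_integral => t _.
    by rewrite patchE /F indicE/=; case: ifPn => _; rewrite ?mul1r ?mul0r.
  have dE t : is_derive t (1 : R) (fun s => - expR (- (N * s + h (xi s x))))
      (expR (- (N * t)) * q (xi t x)).
    apply: (is_derive_eq (is_derive_dilation N t x)).
    by rewrite /q /f opprD expRD /D /xi; ring.
  rewrite (FTC_is_derive ltr01 dE); last first.
    move=> t; apply: (@continuousM _ _ (fun t => expR (- (N * t)))
      (fun t => q (xi t x))).
      by apply: differentiable_continuous; apply/derivable1_diffP.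
    by apply: continuous_comp; [exact: continuous_dilation|exact: cq].
  have -> : xi 0 x = x by rewrite /xi expR0 scale1r addrC subrK.
  by congr EFin; rewrite mulr1 mulr0 add0r opprD expRD /f; ring.
have Fub : (\int[mu]_x \int[lebesgue_measure]_t F (t, x) =
    \int[lebesgue_measure]_t \int[mu]_x F (t, x))%E.
  by rewrite (fubini_tonelli F).
have KE : (\int[mu]_x (q x)%:E = (M * j)%:E)%E.
  pose c := (1 - expR (- M)) / M.
  have c0 : 0 < c by rewrite divr_gt0// subr_gt0 expR_lt1; lra.
  have cK : (c%:E * \int[mu]_x (q x)%:E =
      \int[mu]_x (f x - expR (- N) * f (xi 1 x))%:E)%E.
    rewrite -(eq_integral _ _ (fun x _ => innert x)) Fub.
    rewrite (eq_integral _ _ (fun t _ => innerx t)).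
    have me : measurable_fun setT (fun t : measurableTypeR R =>
        (\1_(`[0%R, 1%R]%classic : set R) t * expR (- (M * t)))%:E).
      apply/measurable_EFinP; apply: measurable_funM; first exact: measurable_indic.
      apply: (measurableT_comp (f := expR)) => //; apply: measurable_funN.
      exact: measurable_funM.
    by rewrite ge0_integralZr ?expM// => t _;
      rewrite lee_fin indicE mulr_ge0// expR_ge0.
  have mfx : measurable_fun setT (fun x => f (xi 1 x)).
    apply: (measurableT_comp mf).
    exact: (measurableT_comp mxi (measurable_pair1 (1 : measurableTypeR R))).
  have fxi : (\int[mu]_x (expR (- N) * f (xi 1 x))%:E = (expR (- M) * j)%:E)%E.
    have mfE : measurable_fun setT (fun x => (f (xi 1 x))%:E) by exact/measurable_EFinP.
    have fE0 x : setT x -> (0 <= (f (xi 1 x))%:E)%E by rewrite lee_fin.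
    under eq_integral do rewrite EFinM.
    rewrite (ge0_integralZl_EFin _ measurableT fE0 mfE (expR_ge0 _)).
    have := integral_dilation 1 mf f0; rewrite -/(xi 1) => ->.
    rewrite jE -!EFinM mulrA -expRD; congr (expR _ * _)%:E.
    by rewrite /M; ring.
  have diff0 x : 0 <= f x - expR (- N) * f (xi 1 x).
    rewrite -lee_fin -innert; apply: integral_ge0 => t _; exact: F0.
  have : (\int[mu]_x (f x)%:E = \int[mu]_x (f x - expR (- N) * f (xi 1 x))%:E +
      (expR (- M) * j)%:E)%E.
    rewrite -fxi -ge0_integralD//.
    - by apply: eq_integral => x _; rewrite -EFinD subrK.
    - by move=> x _; rewrite lee_fin.
    - apply/measurable_EFinP; apply: measurable_funB => //.
      exact: measurable_funM.
    - by move=> x _; rewrite lee_fin mulr_ge0// expR_ge0.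
    - by apply/measurable_EFinP; exact: measurable_funM.
  rewrite jE -cK => cKj.
  have -> : (\int[mu]_x (q x)%:E = (c^-1)%:E * (c%:E * \int[mu]_x (q x)%:E))%E.
    by rewrite muleA -EFinM mulVf ?mul1e// gt_eqF.
  have -> : (c%:E * \int[mu]_x (q x)%:E = (j - expR (- M) * j)%:E)%E.
    by rewrite EFinB cKj addeK.
  rewrite -EFinM; congr EFin; rewrite /c; field.
  by rewrite gt_eqF//= subr_eq0 gt_eqF// expR_lt1; lra.
have qi : mu.-integrable setT (EFin \o q).
  apply/integrableP; split; first exact/measurable_EFinP.
  rewrite (eq_integral (fun x => (q x)%:E)) => [|x _]; last by rewrite /= ger0_norm.
  by rewrite KE ltry.
have DE : (fun x => (D x * f x)%:E) = (EFin \o q \- (fun x => N%:E * (f x)%:E))%E.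
  by apply/funext => x; rewrite /= -?EFinM -EFinB; congr EFin; rewrite /q; ring.
have Nfi : mu.-integrable setT (fun x => N%:E * (f x)%:E)%E.
  exact: integrableZl.
rewrite DE; split; first exact: integrableB.
rewrite integralB//= integralZl// KE jE -!EFinM -EFinB; congr EFin.
by rewrite /M; ring.
Qed.

End integration_by_parts.

(** * The difference quotients of the total mass *)

Lemma integral_lin2 {d} {T : measurableType d} {R : realType}
    (mu : {measure set T -> \bar R}) (F G : T -> R) (x y i j : R) :
  mu.-integrable setT (fun w => (F w)%:E) ->
  mu.-integrable setT (fun w => (G w)%:E) ->
  (\int[mu]_w (F w)%:E = i%:E)%E -> (\int[mu]_w (G w)%:E = j%:E)%E ->
  mu.-integrable setT (fun w => (x * F w + y * G w)%:E) /\
  (\int[mu]_w (x * F w + y * G w)%:E = (x * i + y * j)%:E)%E.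
Proof.
move=> iF iG Fi Gj.
have ixF : mu.-integrable setT (fun w => x%:E * (F w)%:E)%E by exact: integrableZl.
have iyG : mu.-integrable setT (fun w => y%:E * (G w)%:E)%E by exact: integrableZl.
have E : (fun w => (x * F w + y * G w)%:E) =
    ((fun w => x%:E * (F w)%:E) \+ (fun w => y%:E * (G w)%:E))%E.
  by apply/funext => w; rewrite /= EFinD !EFinM.
rewrite E; split; first exact: integrableD.
by rewrite integralD//= !integralZl// Fi Gj -!EFinM -EFinD.
Qed.

Lemma is_derive_cvg_quotient {R : realType} (F : R -> R) (d : R) (t : nat -> R) :
  is_derive (0 : R) (1 : R) F d -> (forall n, 0 < t n) -> t n @[n --> \oo] --> 0 ->
  (F (t n) - F 0) / t n @[n --> \oo] --> d.
Proof.
move=> /is_deriveP dF t0 tcvg; apply/cvgrPdist_le => e e0.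
have near_t := tcvg _ (dF e e0).
near=> n; have : `|F (0 + t n *: 1) - F 0 - t n * d| <= e * `|t n| by near: n.
rewrite add0r /GRing.scale/= mulr1 (gtr0_norm (t0 n)) => Ft.
rewrite -(ler_pM2r (t0 n)); apply: le_trans Ft.
set q := (F (t n) - F 0) / t n.
have -> : `|d - q| * t n = `|q * t n - t n * d|.
  by rewrite -[in LHS](gtr0_norm (t0 n)) -normrM mulrBl distrC (mulrC d).
by rewrite /q divfK// gt_eqF.
Unshelve. all: by end_near. Qed.

Section first_variation.
Context {R : realType} {n : nat}.
Variables (h k : 'rV[R]_n -> R) (a : 'rV[R]_n) (b c : R).
Hypotheses (sh : smooth_convex h) (slh : superlinear h) (slk : superlinear k).
Local Notation mu := (lebesgue_rV R n).

Let u : 'rV[R]_n -> \bar R := EFin \o h.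
Let v : 'rV[R]_n -> \bar R := EFin \o k.
Let f x := expR (- h x).

Definition conj_gradient x : R := fine (fenchel v (gradient h x)).
Local Notation psi := conj_gradient.

(* [psi_le] is the inequality c K <= H - <a, .> - b between the conjugates H of h
   and K of k at the point grad h x, where H takes the value
   <x, grad h x> - h x. *)
Hypothesis c0 : 0 < c.
Hypothesis psi_le : forall x, c * psi x <= dotv (x - a) (gradient h x) - h x - b.

(** The potential of the perturbed function for t > 0, where the infimal
    convolution is finite. *)
Definition perturbed t x : R := fine (infconv u (rscale v t) x).
Local Notation P := perturbed.

Let young x z : dotv z (gradient h x) - k z <= psi x.
Proof. by rewrite -lee_fin fineK ?fenchel_fin_num// fenchel_young. Qed.

Lemma perturbed_ge_tangent t x z : 0 < t ->
  h x - t * psi x <= h (x - t *: z) + t * k z.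
Proof.
move=> t0; have [ch _ dh _] := sh.
have := convex_ge_gradient (x - t *: z) ch (dh x).
have -> : x - t *: z - x = - (t *: z) by rewrite addrC addKr.
rewrite dotvNr dotvZr dotvC.
have := ler_wpM2l (ltW t0) (young x z); rewrite mulrBr; lra.
Qed.

Lemma infconv_fin_num t x : 0 < t -> infconv u (rscale v t) x \is a fin_num.
Proof.
move=> t0; apply/fin_real/andP; split.
  apply: (@lt_le_trans _ _ (h x - t * psi x)%:E); first exact: ltNyr.
  by apply: infconv_rscale_ge => // z; rewrite lee_fin perturbed_ge_tangent.
by apply: le_lt_trans (infconv_rscale_le _ _ _ 0 t0) _; exact: ltry.
Qed.

Lemma EFin_perturbed t x : 0 < t -> infconv u (rscale v t) x = (P t x)%:E.
Proof. by move=> t0; rewrite /P fineK// infconv_fin_num. Qed.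

Lemma perturbed_le t x z : 0 < t -> P t x <= h (x - t *: z) + t * k z.
Proof. by move=> t0; rewrite -lee_fin -EFin_perturbed// infconv_rscale_le. Qed.

Lemma perturbed_ge t x m : 0 < t ->
  (forall z, m <= h (x - t *: z) + t * k z) -> m <= P t x.
Proof.
move=> t0 mz; rewrite -lee_fin -EFin_perturbed//; exact: infconv_rscale_ge.
Qed.

Lemma measurable_perturbed t : 0 < t -> measurable_fun setT (P t).
Proof.
move=> t0; apply/measurable_EFinP.
rewrite (_ : EFin \o P t = infconv u (rscale v t)); last first.
  by apply/funext => x; rewrite EFin_perturbed.
by apply: usc_measurable_rV => r; apply: open_infconv_lt => //; case: sh.
Qed.

Let xi (t : R) (x : 'rV[R]_n) : 'rV[R]_n := a + (1 + t / c)^-1 *: (x - a).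

(** Bound h (x - t z) below by the tangent of h at xi, and k z by Young's
    inequality at the slope grad h xi.  The terms in z cancel, and [psi_le]
    bounds the remaining t psi xi by values at xi.  The point xi is chosen such
    that x - xi = s (xi - a) with s = t / c, which makes the inner products with
    grad h xi cancel too. *)
Lemma perturbed_ge_dilation t x : 0 < t ->
  (1 + t / c) * h (xi t x) + t / c * b <= P t x.
Proof.
move=> t0; apply: perturbed_ge => // z; have [ch _ dh _] := sh.
set s := t / c; have s0 : 0 < s by rewrite divr_gt0.
have s10 : 1 + s != 0 by rewrite gt_eqF// addr_gt0.
set y := xi t x; pose e := gradient h y.
have xy : x - y = s *: (y - a).
  by apply/rowP => i; rewrite !mxE -/s; field.
have := convex_ge_gradient (x - t *: z) ch (dh y).
have -> : x - t *: z - y = s *: (y - a) - t *: z by rewrite -xy addrAC.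
rewrite -/e dotvBr !dotvZr (dotvC e z) (dotvC e (y - a)).
have := ler_wpM2l (ltW t0) (young y z); rewrite -/e mulrBr.
have := ler_wpM2l (ltW s0) (psi_le y); rewrite -/e.
have -> : s * (c * psi y) = t * psi y by rewrite mulrA /s divfK// gt_eqF.
rewrite !mulrBr mulrDl mul1r; lra.
Qed.

Section along_a_sequence.
Variable t : nat -> R.
Hypotheses (t0 : forall i, 0 < t i) (tcvg : t i @[i --> \oo] --> 0).

Let quotient i x := (expR (- P (t i) x) - f x) / t i.

Lemma quotient_ge i x z :
  (expR (- (h (x - t i *: z) + t i * k z)) - f x) / t i <= quotient i x.
Proof.
rewrite ler_pM2r ?invr_gt0// lerD2r ler_expR lerN2.
exact: perturbed_le.
Qed.

Lemma quotient_le i x :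
  quotient i x <= (expR (- (h x - t i * psi x)) - f x) / t i.
Proof.
rewrite ler_pM2r ?invr_gt0// lerD2r ler_expR lerN2.
by apply: perturbed_ge => // z; exact: perturbed_ge_tangent.
Qed.

(** The quotient lies between two difference quotients of explicit functions.
    The slope of the lower one depends on z, and z is chosen to come within a
    prescribed distance of the supremum that defines the conjugate. *)
Lemma cvg_quotient x : quotient i x @[i --> \oo] --> psi x * f x.
Proof.
have [ch _ dh _] := sh; have f0 : 0 < f x by exact: expR_gt0.
have upper : (expR (- (h x - t i * psi x)) - f x) / t i @[i --> \oo] --> psi x * f x.
  have dG : is_derive (0 : R) (1 : R) (fun s => h x - s * psi x) (- psi x).
    apply: is_derive_eq; rewrite /GRing.scale/=; ring.
  have := is_derive_cvg_quotient (is_derive_expRN dG) t0 tcvg.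
  by rewrite mul0r subr0 opprK.
have lower z : (expR (- (h (x - t i *: z) + t i * k z)) - f x) / t i @[i --> \oo] -->
    (dotv z (gradient h x) - k z) * f x.
  have dl := is_derive_line x (- z) 0 ch dh.
  have dG : is_derive (0 : R) (1 : R) (fun s => h (x + s *: - z) + s * k z)
      (dotv (gradient h (x + 0 *: - z)) (- z) + k z).
    apply: is_deriveD; apply: is_derive_eq; rewrite /GRing.scale/=; ring.
  have := is_derive_cvg_quotient (is_derive_expRN dG) t0 tcvg.
  rewrite scale0r mul0r !addr0 dotvNr dotvC opprD opprK.
  by under eq_cvg do rewrite scalerN.
suff : forall e : R, 0 < e -> \forall i \near \oo, `|psi x * f x - quotient i x| <= e.
  by move=> near_psi; apply/cvgrPdist_le => e; exact: near_psi.
move=> e e0; have e20 : 0 < e / 2 by rewrite divr_gt0.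
have [z hz] : exists z, psi x - e / 2 / f x < dotv z (gradient h x) - k z.
  have : ((psi x - e / 2 / f x)%:E < fenchel v (gradient h x))%E.
    rewrite -[ltRHS]fineK ?fenchel_fin_num// lte_fin -/(psi x).
    by rewrite ltrBlDr ltrDl divr_gt0.
  by move=> /ereal_sup_gt[_ [z _ <-]]; rewrite lte_fin; exists z.
have {}hz : psi x * f x - e / 2 < (dotv z (gradient h x) - k z) * f x.
  by rewrite -(ltr_pM2r f0) mulrBl divfK ?gt_eqF in hz.
move/cvgrPdist_le : upper => /(_ _ e0) up.
move/cvgrPdist_le : (lower z) => /(_ _ e20) lo.
near=> i.
have := quotient_le i x; have := quotient_ge i x z.
have : `|psi x * f x - (expR (- (h x - t i * psi x)) - f x) / t i| <= e by near: i.
have : `|(dotv z (gradient h x) - k z) * f x -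
  (expR (- (h (x - t i *: z) + t i * k z)) - f x) / t i| <= e / 2 by near: i.
rewrite !ler_norml => /andP[_ l1] /andP[l2 _] l3 l4.
by apply/andP; split; lra.
Unshelve. all: by end_near. Qed.

Lemma quotient_ge_cst i x : - k 0 * f x <= quotient i x.
Proof.
apply: le_trans (quotient_ge i x 0); rewrite scaler0 subr0 opprD expRD -/(f x).
rewrite ler_pdivlMr// -mulrAC mulrC.
have := expR_ge1Dx (- (t i * k 0)); rewrite -(ler_pM2l (expR_gt0 (- h x))) -/(f x).
by rewrite mulrDr mulr1; lra.
Qed.

Variable m : R.
Hypothesis hm : forall x, m <= h x.
Let beta := b + m.

(* The term s / c h xi of the lower bound is replaced by s / c m, so that
   the integral of the majorant involves only f. *)
Let dilated (s : R) (x : 'rV[R]_n) := expR (- (h (xi s x) + s / c * beta)).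
Let majorant i (x : 'rV[R]_n) := (dilated (t i) x - f x) / t i.

Lemma exp_perturbed_le s x : 0 < s -> expR (- P s x) <= dilated s x.
Proof.
move=> s0; rewrite ler_expR lerN2; apply: le_trans (perturbed_ge_dilation x s0).
have := hm (xi s x); rewrite -(ler_pM2l (divr_gt0 s0 c0)) /beta mulrDr mulrDl; lra.
Qed.

Lemma quotient_le_majorant i x : quotient i x <= majorant i x.
Proof. by rewrite ler_pM2r ?invr_gt0// lerD2r exp_perturbed_le. Qed.

Lemma cvg_majorant x : majorant i x @[i --> \oo] -->
  c^-1 * (dotv (x - a) (gradient h x) * f x - beta * f x).
Proof.
have [ch _ dh _] := sh.
have d1 : is_derive (0 : R) (1 : R) (fun s => 1 + s / c) c^-1.
  by apply: is_derive_eq; rewrite /GRing.scale/=; ring.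
have e1 : (1 + 0 / c)^-1 = 1 :> R by rewrite mul0r addr0 invr1.
have x0 : xi 0 x = x by rewrite /xi e1 scale1r addrC subrK.
have dV : is_derive (0 : R) (1 : R) (fun s => (1 + s / c)^-1) (- c^-1).
  have n0 : 1 + 0 / c != 0 by rewrite mul0r addr0 oner_eq0.
  have := (@is_deriveV _ (fun s => 1 + s / c) 0 _ 1 n0 d1).
  move=> H; apply: (is_derive_eq H).
  by rewrite mul0r addr0 /GRing.scale/= expr1n invr1 mulN1r.
have dh' : is_derive (0 : R) (1 : R) (fun s => h (xi s x))
    (dotv (gradient h x) (x - a) * - c^-1).
  have := is_derive_line a (x - a) ((1 + 0 / c)^-1) ch dh; rewrite -/(xi 0 x) x0 => dl.
  exact: (@is_derive1_comp _ (fun r => h (a + r *: (x - a)))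
    (fun s => (1 + s / c)^-1) 0 _ _ dl dV).
have db : is_derive (0 : R) (1 : R) (fun s => s / c * beta) (c^-1 * beta).
  by apply: is_derive_eq; rewrite /GRing.scale/=; ring.
have dG := is_deriveD dh' db.
have := is_derive_cvg_quotient (is_derive_expRN dG) t0 tcvg.
rewrite /= !fctE x0 !mul0r addr0 -/(f x) => H.
rewrite (_ : c^-1 * _ = - (dotv (gradient h x) (x - a) * - c^-1 + c^-1 * beta) * f x)//.
by rewrite (dotvC (gradient h x)); ring.
Qed.

Let J := (\int[mu]_x (f x)%:E)%E.

(** The dilation by the factor 1 / (1 + s / c) is written as exp (- ln _), so that
    the powers of the Jacobian appear as an exponential. *)
Lemma integral_dilated (s : R) : 0 < s ->
  (\int[mu]_x (dilated s x)%:E =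
   (expR (- (s / c * beta - n%:R * ln (1 + s / c))))%:E * J)%E.
Proof.
move=> s0; have s1 : 0 < 1 + s / c by rewrite addr_gt0// divr_gt0.
have [_ ch _ _] := sh.
have mf : measurable_fun setT f.
  by apply: continuous_measurable_rV; exact: continuous_expRN.
have e0 : 0 <= expR (- (s / c * beta)) by exact: expR_ge0.
pose r := - ln (1 + s / c).
have rE : expR r = (1 + s / c)^-1 by rewrite expRN lnK.
have mfr : measurable_fun setT (fun x : 'rV[R]_n => (f (a + expR r *: (x - a)))%:E).
  apply/measurable_EFinP; apply: (measurableT_comp mf).
  apply: measurable_fun_rV => i; under eq_fun do rewrite !mxE.
  apply: measurable_funD => //; apply: measurable_funM => //.
  by apply: measurable_funB => //; exact: measurable_rV_coord.
rewrite (eq_integral (fun x : 'rV[R]_n => (expR (- (s / c * beta)))%:E *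
  (f (a + expR r *: (x - a)))%:E)%E); last first.
  by move=> x _; rewrite -EFinM -expRD /dilated /xi rE; congr (expR _)%:E; ring.
rewrite ge0_integralZl_EFin//; last by move=> x _; rewrite lee_fin expR_ge0.
rewrite (integral_dilation a r mf) => [|x]; last exact: expR_ge0.
rewrite muleA -EFinM -expRD; congr ((expR _)%:E * _)%E; rewrite /r; ring.
Qed.

Lemma measurable_dilated (s : R) : measurable_fun setT (dilated s).
Proof.
have [_ ch _ _] := sh.
apply: (measurableT_comp (f := expR)) => //; apply: measurable_funN.
apply: measurable_funD => //; apply: (measurableT_comp (continuous_measurable_rV ch)).
apply: measurable_fun_rV => i; under eq_fun do rewrite !mxE.
apply: measurable_funD => //; apply: measurable_funM => //.
by apply: measurable_funB => //; exact: measurable_rV_coord.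
Qed.

Lemma integrable_exp_potential : mu.-integrable setT (fun x => (f x)%:E).
Proof. by case: sh => _ ch _ _; exact: integrable_expRN_superlinear. Qed.

Lemma integrable_dilated (s : R) : 0 < s ->
  mu.-integrable setT (fun x => (dilated s x)%:E).
Proof.
move=> s0; apply/integrableP; split.
  by apply/measurable_EFinP; exact: measurable_dilated.
rewrite (eq_integral (fun x => (dilated s x)%:E)); last first.
  by move=> x _; rewrite /= ger0_norm// expR_ge0.
rewrite integral_dilated// ltey_eq fin_numM//.
exact: integrable_fin_num integrable_exp_potential.
Qed.

Lemma integrable_exp_perturbed (s : R) : 0 < s ->
  mu.-integrable setT (fun x => (expR (- P s x))%:E).
Proof.
move=> s0; apply: le_integrable (integrable_dilated s0) => //.
  apply/measurable_EFinP; apply: (measurableT_comp (f := expR)) => //.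
  by apply: measurable_funN; exact: measurable_perturbed.
by move=> x _; rewrite /= lee_fin !ger0_norm ?expR_ge0// exp_perturbed_le.
Qed.

(** The quotients and their majorants are shifted by k 0 times f, a lower bound
    of the quotients being - k 0 times f, which makes them nonnegative. *)
Lemma cvg_variation :
  mu.-integrable setT (fun x => (psi x * f x)%:E) /\
  (fine (\int[mu]_x (expR (- P (t i) x))%:E)%E - fine J) / t i @[i --> \oo] -->
    fine (\int[mu]_x (psi x * f x)%:E)%E.
Proof.
have fin (F : 'rV[R]_n -> R) : mu.-integrable setT (fun x => (F x)%:E) ->
    (\int[mu]_x (F x)%:E = (fine (\int[mu]_x (F x)%:E))%:E)%E.
  by move=> iF; rewrite fineK//; exact: integrable_fin_num iF.
have jE : J = (fine J)%:E := fin _ integrable_exp_potential; set j := fine J in jE *.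
have pE i := fin _ (integrable_exp_perturbed (t0 i)).
set p := fun i => fine (\int[mu]_x (expR (- P (t i) x))%:E)%E in pE *.
pose e s := expR (- (s / c * beta - n%:R * ln (1 + s / c))).
have dE i : (\int[mu]_x (dilated (t i) x)%:E = (e (t i) * j)%:E)%E.
  by rewrite integral_dilated// jE -EFinM.
pose D x := dotv (x - a) (gradient h x) * f x.
have [iD DE] := integral_radial_derivative a sh slh.
have {}DE : (\int[mu]_x (D x)%:E = (n%:R * j)%:E)%E.
  by rewrite DE EFinM -jE.
pose gs i x := (t i)^-1 * expR (- P (t i) x) + (k 0 - (t i)^-1) * f x.
pose Gs i x := (t i)^-1 * dilated (t i) x + (k 0 - (t i)^-1) * f x.
pose g0 x := psi x * f x + k 0 * f x.
pose G0 x := c^-1 * D x + (k 0 - beta / c) * f x.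
have gsE i x : gs i x = quotient i x + k 0 * f x by rewrite /gs /quotient; ring.
have GsE i x : Gs i x = majorant i x + k 0 * f x by rewrite /Gs /majorant; ring.
have [iG0 G0E] := integral_lin2 c^-1 (k 0 - beta / c) iD integrable_exp_potential DE jE.
have iGs i := (integral_lin2 (t i)^-1 (k 0 - (t i)^-1)
  (integrable_dilated (t0 i)) integrable_exp_potential (dE i) jE).1.
have GsI i := (integral_lin2 (t i)^-1 (k 0 - (t i)^-1)
  (integrable_dilated (t0 i)) integrable_exp_potential (dE i) jE).2.
have igs i := (integral_lin2 (t i)^-1 (k 0 - (t i)^-1)
  (integrable_exp_perturbed (t0 i)) integrable_exp_potential (pE i) jE).1.
have gsI i := (integral_lin2 (t i)^-1 (k 0 - (t i)^-1)
  (integrable_exp_perturbed (t0 i)) integrable_exp_potential (pE i) jE).2.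
have de : is_derive (0 : R) (1 : R) e ((n%:R - beta) / c).
  have d1 : is_derive (0 : R) (1 : R) (fun s => 1 + s / c) c^-1.
    by apply: is_derive_eq; rewrite /GRing.scale/=; ring.
  have e1 : 1 + 0 / c = 1 :> R by rewrite mul0r addr0.
  have dln : is_derive (1 + 0 / c) (1 : R) (@ln R) 1.
    by rewrite e1; have := is_derive1_ln (ltr01 : 0 < (1 : R)); rewrite invr1.
  have dc := @is_derive1_comp _ (@ln R) (fun s => 1 + s / c) 0 _ _ dln d1.
  have db : is_derive (0 : R) (1 : R) (fun s => s / c * beta) (c^-1 * beta).
    by apply: is_derive_eq; rewrite /GRing.scale/=; ring.
  have dG := is_deriveB db (is_deriveZ n%:R dc).
  apply: (is_derive_eq (is_derive_expRN dG)).
  rewrite /= !fctE /= e1 ln1 !mul0r /GRing.scale/= mulr0 subr0 oppr0 expR0; ring.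
have e0 : e 0 = 1 by rewrite /e mul0r addr0 ln1 mul0r mulr0 subr0 oppr0 expR0.
have gbound i x : 0 <= gs i x <= Gs i x.
  rewrite gsE GsE lerD2r quotient_le_majorant andbT.
  by have := quotient_ge_cst i x; lra.
have gcvg x : gs i x @[i --> \oo] --> g0 x.
  under eq_cvg do rewrite gsE.
  by apply: cvgD; [exact: cvg_quotient|exact: cvg_cst].
have Gcvg x : Gs i x @[i --> \oo] --> G0 x.
  under eq_cvg do rewrite GsE.
  rewrite (_ : G0 x = c^-1 * (D x - beta * f x) + k 0 * f x); last first.
    by rewrite /G0; ring.
  by apply: cvgD; [exact: cvg_majorant|exact: cvg_cst].
have mgs i : measurable_fun setT (gs i).
  by apply/measurable_EFinP; exact: measurable_int (igs i).
have IGcvg : (\int[mu]_x (Gs i x)%:E @[i --> \oo] --> \int[mu]_x (G0 x)%:E)%E.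
  rewrite G0E; under eq_cvg do rewrite GsI.
  apply: cvg_EFin; first exact: nearW.
  have := is_derive_cvg_quotient de t0 tcvg; rewrite e0 => ecvg.
  rewrite (_ : c^-1 * _ + _ = (n%:R - beta) / c * j + k 0 * j); last by ring.
  rewrite (_ : fine \o _ = fun i => (e (t i) - 1) / t i * j + k 0 * j); last first.
    by apply/funext => i /=; ring.
  apply: cvgD; last exact: cvg_cst.
  by apply: cvgM => //; exact: cvg_cst.
have [ig0 Igcvg] := pratt_convergence mgs gbound gcvg Gcvg iGs iG0 IGcvg.
have [ipsi psiE] := integral_lin2 1 (- k 0) ig0 integrable_exp_potential (fin _ ig0) jE.
have psiE' : (fun x => (1 * g0 x + - k 0 * f x)%:E) = (fun x => (psi x * f x)%:E).
  by apply/funext => x; congr EFin; rewrite /g0; ring.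
rewrite psiE' in ipsi psiE; split => //.
rewrite psiE /=.
move: Igcvg; rewrite (fin _ ig0); under eq_cvg do rewrite gsI; move=> /fine_cvg Igcvg.
rewrite (_ : (fun i => (p i - j) / t i) =
  fun i => (fine \o (fun i => ((t i)^-1 * p i + (k 0 - (t i)^-1) * j)%:E)) i -
    k 0 * j); last first.
  by apply/funext => i /=; ring.
rewrite mul1r mulNr; apply: cvgB => //; exact: cvg_cst.
Qed.

End along_a_sequence.

End first_variation.

(** * The first variation of the total mass *)

Section conjugate.
Context {R : realType} {n : nat}.
Implicit Types (h k : 'rV[R]_n -> R) (u : 'rV[R]_n -> \bar R).

Lemma potentialK u : potential (exp_neg u) = u.
Proof. by apply/funext => x; rewrite /potential /exp_neg expeRK oppeK. Qed.

Lemma classA'_exp_neg u : classA' (exp_neg u) -> classL' u.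
Proof. by move=> [w [Lw /(congr1 potential)]]; rewrite !potentialK => ->. Qed.

(** A supremum of continuous functions is lower semicontinuous. *)
Lemma measurable_fenchel h : measurable_fun setT (fenchel (EFin \o h)).
Proof.
apply: lsc_measurable_rV => r.
rewrite (_ : [set y | _] = \bigcup_x [set y | (r < (dotv x y - h x)%:E)%E]).
  apply: bigcup_open => x _.
  apply: (@open_comp _ _ (fun y => dotv x y - h x) [set s | (r < s%:E)%E]).
    move=> y _; apply: (@continuousB _ R^o _ (dotv x) (cst (h x))).
      exact: continuous_dotvr.
    exact: cst_continuous.
  exact: open_ereal_gt.
apply/seteqP; split=> y /=.
  by move=> /ereal_sup_gt[_ [x _ <-] rx]; exists x.
by move=> [x _ rx]; apply: (lt_le_trans rx); exact: fenchel_young.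
Qed.

Lemma measurable_gradient h : (forall i, continuous (partial i h)) ->
  measurable_fun setT (gradient h).
Proof.
move=> ch; apply: measurable_fun_rV => i; under eq_fun do rewrite mxE.
exact: continuous_measurable_rV.
Qed.

Lemma admissible_affine_minorant h k (c : R) :
  smooth_convex h -> superlinear h -> superlinear k ->
  econvex (fun y => fenchel (EFin \o h) y - c%:E * fenchel (EFin \o k) y)%E ->
  exists a b, forall x, c * conj_gradient h k x <=
    dotv (x - a) (gradient h x) - h x - b.
Proof.
move=> sh slh slk [_ cw].
pose W y := fine (fenchel (EFin \o h) y) - c * fine (fenchel (EFin \o k) y).
have WE y : (fenchel (EFin \o h) y - c%:E * fenchel (EFin \o k) y = (W y)%:E)%E.
  by rewrite -[fenchel (EFin \o h) y]fineK ?fenchel_fin_num//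
    -[fenchel (EFin \o k) y]fineK ?fenchel_fin_num// -EFinM -EFinB.
have [|a aW] := @convex_affine_minorant _ _ W.
  move=> x y t t01; have := cw x y t t01.
  by rewrite !WE -!EFinM -EFinD lee_fin.
exists a, (W 0) => x; have := aW (gradient h x).
rewrite {2}/W fenchel_gradient//= -/(conj_gradient h k x) dotvBl (dotvC a); lra.
Qed.

End conjugate.

Local Open Scope ereal_scope.

Theorem theorem4p5 (R : realType) (n : nat) (n_ge1 : (1 <= n)%N)
    (u v f g : 'rV[R]_n -> \bar R)
    (fE : f = exp_neg u) (gE : g = exp_neg v)
    (fA : classA' f) (gA : classA' g)
    (fg : admissible f g) :
  [/\ cvg (Jquotient f g t @[t --> 0^'+]),
      deltaJ f g \is a fin_num
    & deltaJ f g = \int[mu_of f]_y fenchel v y].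
Proof.
subst f g; move: fA gA fg => /classA'_exp_neg Lu /classA'_exp_neg Lv.
have [h [-> sh slh]] := classL'_real Lu.
have [k [-> _ slk]] := classL'_real Lv.
set f := exp_neg (EFin \o h); set g := exp_neg (EFin \o k).
have fh : potential f = EFin \o h by exact: potentialK.
have gk : potential g = EFin \o k by exact: potentialK.
rewrite /admissible fh gk => -[c c0 /(admissible_affine_minorant sh slh slk)].
move=> [a [b psi_le]]; have [m hm] := superlinear_bounded_below slh.
pose I := \int[lebesgue_rV R n]_x (conj_gradient h k x * expR (- h x))%:E.
have quotientE t : (0 < t)%R -> Jquotient f g t =
    ((fine (\int[lebesgue_rV R n]_x (expR (- perturbed h k t x))%:E) -
      fine (\int[lebesgue_rV R n]_x (expR (- h x))%:E)) / t)%:E.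
  move=> t0; rewrite EFinM EFinB !fineK.
  - rewrite /Jquotient /totalJ; congr ((_ - _) * _); apply: eq_integral => x _.
    by rewrite /oplus fh gk /exp_neg (EFin_perturbed sh slk).
  - exact: integrable_fin_num (integrable_exp_potential sh slh).
  - exact: integrable_fin_num (integrable_exp_perturbed sh slh slk c0 psi_le hm t0).
(* The integrability of the limit comes with the convergence along any
   sequence that decreases to 0. *)
have Ifin : I \is a fin_num.
  have [H _] := cvg_variation sh slh slk c0 psi_le harmonic_gt0 cvg_harmonic hm.
  exact: integrable_fin_num H.
have Jcvg : Jquotient f g t @[t --> 0^'+] --> I.
  rewrite -(fineK Ifin); apply: cvg_EFin.
    by near=> t; rewrite quotientE.
  apply/cvg_at_rightP => t [t0 tcvg].
  have [_ H] := cvg_variation sh slh slk c0 psi_le t0 tcvg hm.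
  by under eq_cvg do rewrite /= quotientE//.
have JE : deltaJ f g = I by exact/cvg_lim.
split; [by apply/cvg_ex; exists I|by rewrite JE|rewrite JE].
have [_ ch _ ch'] := sh.
have -> : mu_of f =
    density_pushforward (lebesgue_rV R n) (fun x => expR (- h x)) (gradient h).
  by rewrite /mu_of fh.
rewrite integral_density_pushforward.
- apply: eq_integral => x _.
  by rewrite EFinM /conj_gradient fineK ?fenchel_fin_num.
- by apply: continuous_measurable_rV; exact: continuous_expRN.
- by move=> x; exact: expR_ge0.
- exact: measurable_gradient.
- exact: measurable_fenchel.
Unshelve. all: by end_near. Qed.
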